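(* Let $\mathcal{L}=(n,\mathcal{M},\mathcal{C})$ be a simple linearization for which the undirected graph $G(D(\mathcal{L}))$ is acyclic, and let $a\in\mathbb{Q}^{\mathcal{M}}$. Then the problem $\min\{\sum_{m\in\mathcal{M}}a_m\prod_{i\in m}x_i: x\in\{0,1\}^n\}$ can be solved in time $O(|\mathcal{M}|^2)$ in the RAM model.
   Context: A monomial is a nonempty subset $m\subseteq[n]$. A linearization is a triple $\mathcal{L}=(n,\mathcal{M},\mathcal{C})$, where $\mathcal{M}$ is a set of monomials containing all singletons $\{i\}$, $i\in[n]$, and $\mathcal{C}$ is a set of AND-constraints; each AND-constraint is a set $c\subseteq\mathcal{M}$ whose union $\bigcup c$ (its resultant) lies in $\mathcal{M}$. Linearizations are assumed consistent: each non-singleton $m\in\mathcal{M}$ is the resultant of some $c\in\mathcal{C}$ with $|m'|<|m|$ for all $m'\in c$. $\mathcal{L}$ is simple if each non-singleton monomial in $\mathcal{M}$ is the resultant of exactly one AND-constraint and $|\mathcal{C}|$ equals the number of non-singleton monomials in $\mathcal{M}$. For simple $\mathcal{L}$, $D(\mathcal{L})$ is the digraph with node set $\mathcal{M}$ and, for each $c\in\mathcal{C}$, arcs from $\bigcup c$ to each $m\in c$; $G(D(\mathcal{L}))$ is its underlying undirected graph. *)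

(* Defs.v *)
From HB Require Import structures.
From mathcomp Require Import all_boot all_order all_algebra.
Set Implicit Arguments. Unset Strict Implicit. Unset Printing Implicit Defensive.
Import Order.TTheory GRing.Theory Num.Theory.
Local Open Scope ring_scope.

(* Linearizations.  Variables are indexed by 'I_n (i.e. [n] shifted   *)
(* to {0,...,n-1}); a monomial is a set of variables.                 *)

Section Linearization.
Variable n : nat.
Implicit Types (M : {set {set 'I_n}}) (C : {set {set {set 'I_n}}}).

Definition resultant (c : {set {set 'I_n}}) : {set 'I_n} := \bigcup_(m in c) m.

Definition is_linearization M C : Prop :=
  (forall m, m \in M -> m != set0) /\
  (forall i : 'I_n, [set i] \in M) /\
  (forall c, c \in C -> c \subset M /\ resultant c \in M).

Definition consistent M C : Prop :=
  forall m, m \in M -> (1 < #|m|)%N ->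
    exists2 c, c \in C &
      resultant c = m /\ (forall m', m' \in c -> (#|m'| < #|m|)%N).

Definition simple_lin M C : Prop :=
  (forall m, m \in M -> (1 < #|m|)%N ->
     #|[set c in C | resultant c == m]| = 1%N) /\
  #|C| = #|[set m in M | (1 < #|m|)%N]|.

Definition arc M C (u v : {set 'I_n}) : bool :=
  [exists c in C, (resultant c == u) && (v \in c)].

Definition undir_adj M C (u v : {set 'I_n}) : bool :=
  [&& u \in M, v \in M, u != v & arc M C u v || arc M C v u].

Definition acyclic_G M C : Prop :=
  forall s : seq {set 'I_n}, uniq s -> (3 <= size s)%N ->
    ~~ cycle (undir_adj M C) s.

Definition objective M (a : {set 'I_n} -> rat) (x : {ffun 'I_n -> bool}) : rat :=
  \sum_(m in M) a m * \prod_(i in m) ((x i : nat)%:R : rat).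

End Linearization.

(* A unit-cost RAM over the rationals.                                *)
(* Memory: nat -> rat.  Each executed instruction costs one step.     *)
(* Indirect addressing is only allowed through registers holding a    *)
(* natural number (otherwise the machine is stuck).                   *)

Inductive instr : Type :=
| IConst (q : rat) (d : nat)
| IAdd (s1 s2 d : nat)
| ISub (s1 s2 d : nat)
| IMul (s1 s2 d : nat)
| ILoad (s d : nat)                   (* mem[d] := mem[mem[s]]            *)
| IStore (s d : nat)                  (* mem[mem[d]] := mem[s]            *)
| IJlt (s1 s2 l : nat)
| IJmp (l : nat)
| IHalt.

Definition memory := nat -> rat.
Definition state := (nat * memory)%type.

Definition upd (m : memory) (d : nat) (q : rat) : memory :=
  fun p => if p == d then q else m p.

Definition addr (r : rat) : option nat :=
  if r \is a Num.nat_num then Some (Num.truncn r) else None.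

(* one step; None if halted (current instruction is IHalt, including
   pc beyond the program) or stuck *)
Definition step (P : seq instr) (s : state) : option state :=
  let: (pc, m) := s in
  match nth IHalt P pc with
  | IConst q d => Some (pc.+1, upd m d q)
  | IAdd s1 s2 d => Some (pc.+1, upd m d (m s1 + m s2))
  | ISub s1 s2 d => Some (pc.+1, upd m d (m s1 - m s2))
  | IMul s1 s2 d => Some (pc.+1, upd m d (m s1 * m s2))
  | ILoad s d => if addr (m s) is Some p then Some (pc.+1, upd m d (m p)) else None
  | IStore s d => if addr (m d) is Some p then Some (pc.+1, upd m p (m s)) else None
  | IJlt s1 s2 l => Some (if m s1 < m s2 then l else pc.+1, m)
  | IJmp l => Some (l, m)
  | IHalt => None
  end.

Fixpoint exec (P : seq instr) (t : nat) (s : state) : option state :=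
  match t with
  | 0 => Some s
  | t'.+1 => if step P s is Some s' then exec P t' s' else None
  end.

Definition halts_in (P : seq instr) (m0 : memory) (t : nat) (mf : memory) : Prop :=
  exists pc, exec P t (0%N, m0) = Some (pc, mf) /\ nth IHalt P pc = IHalt.

(* Input encoding of (n, M, C, a), with N = |M|, monomials m_0..m_{N-1}
   listed by enum M and constraints c_0..c_{|C|-1} listed by enum C:
     mem[0] = n, mem[1] = N, mem[2] = |C|,
     mem[3 + k] = a_{m_k}                                   (k < N),
     mem[3 + N + k*n + i] = [i \in m_k]                     (k < N, i < n),
     mem[3 + N + N*n + j*N + k] = [m_k \in c_j]             (j < |C|, k < N),
     all other cells are 0. *)
Definition encode (n : nat) (M : {set {set 'I_n}}) (C : {set {set {set 'I_n}}})
    (a : {set 'I_n} -> rat) : memory :=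
  fun p =>
    let N := #|M| in
    let eM := enum M in
    let eC := enum C in
    if p == 0%N then n%:R
    else if p == 1%N then N%:R
    else if p == 2%N then #|C|%:R
    else if (p < 3 + N)%N then a (nth set0 eM (p - 3))
    else if (p < 3 + N + N * n)%N then
      let q := (p - (3 + N))%N in
      ([exists i : 'I_n, (i \in nth set0 eM (q %/ n)%N) && (val i == (q %% n)%N)] : nat)%:R
    else if (p < 3 + N + N * n + #|C| * N)%N then
      let q := (p - (3 + N + N * n))%N in
      ((nth set0 eM (q %% N)%N \in nth set0 eC (q %/ N)%N) : nat)%:R
    else 0.

Definition correct_output (n : nat) (M : {set {set 'I_n}}) (a : {set 'I_n} -> rat)
    (mf : memory) : Prop :=
  exists x : {ffun 'I_n -> bool},
    (forall i : 'I_n, mf (val i).+1 = ((x i : nat)%:R : rat)) /\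
    mf 0%N = objective M a x /\
    (forall y : {ffun 'I_n -> bool}, objective M a x <= objective M a y).

(* Main.v *)
Require Import Defs.
From HB Require Import structures.
From mathcomp Require Import all_boot all_order all_algebra zify lra.
Set Implicit Arguments. Unset Strict Implicit. Unset Printing Implicit Defensive.
Import Defs.
Import Order.TTheory GRing.Theory Num.Theory.
Local Open Scope ring_scope.

(** Every non-singleton monomial is the conjunction of the members of its unique
    AND-constraint, so the problem is a constraint network on the forest [G(D(L))]
    and is solved by eliminating leaves: each of [N = |M|] rounds finds a node of
    degree at most one among the remaining ones and folds its two-valued cost table
    into the table of its only neighbour, in time O(N).  Table entries carry the
    code [sum_i x_i 2^-i] of the partial solution attaining them, so that no
    backtracking is needed.  Acyclicity makes the members of a constraint disjoint;
    hence the code of a resultant is the sum of the codes of the members, which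
    allows to identify the resultant in time O(N) per constraint. *)

(** A leaf may lose its parent or its children before it is removed itself, so its last neighbour
    can be of either kind. A removed child enters the conjunction that defines its parent, whereas
    the best cost of a removed parent depends on its remaining child through the value of that
    child. Hence every node carries two tables: [tabF], indexed by the conjunction of the children
    removed so far, and [tabG], indexed by its value. For a resultant that has lost no child this
    conjunction is empty, hence true; the entry for false would have to be infinite, which no
    rational can express, and the flag [unset] takes its place. A non-singleton has at least two
    children, so an unset node is never a leaf.

    One fixed list of instructions has to serve all inputs, and input and output occupy the very
    cells that a program needs as registers. The algorithm is therefore written in a structured
    language whose loops run up to [n] or [N]; a verified compiler bounds its time by a constant
    times [N] to the loop depth, and the input and output are moved separately. As [|C| + n = N],
    the two incidence matrices have [N^2] cells in all, so reading them is affordable. *)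

Fixpoint code_at (P : seq instr) (pc : nat) (l : seq instr) : Prop :=
  if l is i :: l' then nth IHalt P pc = i /\ code_at P pc.+1 l' else True.

Lemma code_at_cat P pc l1 l2 :
  code_at P pc (l1 ++ l2) <-> code_at P pc l1 /\ code_at P (pc + size l1) l2.
Proof.
elim: l1 pc => [|i l1 IH] pc /=; first by rewrite addn0; split=> // -[].
by rewrite IH addnS; split=> [[? []]|[[? ?] ?]].
Qed.

Lemma code_at_full P1 P2 P3 : code_at (P1 ++ P2 ++ P3) (size P1) P2.
Proof.
elim: P2 P1 => [|i P2 IH] P1 //=; split.
  by rewrite nth_cat ltnn subnn.
by have := IH (rcons P1 i); rewrite size_rcons cat_rcons.
Qed.

(** Bounding the number of steps instead of fixing it lets the two branches of a test share one cost
    expression. *)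
Definition reach P s T s' := exists2 k, (k <= T)%N & exec P k s = Some s'.

Lemma exec_add P k1 k2 s s1 :
  exec P k1 s = Some s1 -> exec P (k1 + k2) s = exec P k2 s1.
Proof.
elim: k1 s => [|k1 IH] s /=; first by case=> ->.
by case: (step P s) => // s2; apply: IH.
Qed.

Lemma reach_refl P s T : reach P s T s.
Proof. by exists 0%N. Qed.

Lemma reach_done P pc pc' m T : pc = pc' -> reach P (pc, m) T (pc', m).
Proof. by move=> ->; apply: reach_refl. Qed.

Lemma reach_trans P s1 s2 s3 T1 T2 :
  reach P s1 T1 s2 -> reach P s2 T2 s3 -> reach P s1 (T1 + T2) s3.
Proof.
move=> [k1 le1 e1] [k2 le2 e2]; exists (k1 + k2)%N; first exact: leq_add.
by rewrite (exec_add _ e1).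
Qed.

Lemma reach_le P s s' T T' : reach P s T s' -> (T <= T')%N -> reach P s T' s'.
Proof. by move=> [k le e] le'; exists k => //; apply: leq_trans le'. Qed.

Lemma reach_step P s s1 s' T :
  step P s = Some s1 -> reach P s1 T s' -> reach P s T.+1 s'.
Proof. by move=> e [k le e']; exists k.+1 => //=; rewrite e. Qed.

(** The loop rule: [pc] is the address of the loop test and [I i] the invariant after [i] rounds.
    The final, failing test is left to the caller. *)
Lemma reach_iter P (I : nat -> memory -> Prop) k T pc m :
  (forall i m, (i < k)%N -> I i m ->
     exists2 m', reach P (pc, m) T (pc, m') & I i.+1 m') ->
  I 0%N m -> exists2 m', reach P (pc, m) (k * T) (pc, m') & I k m'.
Proof.
move=> h I0; elim: k h => [|k IH] h; first by exists m => //; apply: reach_refl.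
have [i m1 ik|m1 r1 I1] := IH; first by apply: h; apply: ltnW.
have [m2 r2 I2] := h _ _ (ltnSn k) I1.
by exists m2 => //; rewrite mulSn addnC; apply: reach_trans r1 r2.
Qed.

(** * Rules for single instructions *)

Section Steps.
Variables (P : seq instr) (pc T : nat) (m : memory) (s' : state).

Lemma reach_const q d : nth IHalt P pc = IConst q d ->
  reach P (pc.+1, upd m d q) T s' -> reach P (pc, m) T.+1 s'.
Proof. by move=> e; apply: reach_step; rewrite /step e. Qed.

Lemma reach_add a b d : nth IHalt P pc = IAdd a b d ->
  reach P (pc.+1, upd m d (m a + m b)) T s' -> reach P (pc, m) T.+1 s'.
Proof. by move=> e; apply: reach_step; rewrite /step e. Qed.

Lemma reach_sub a b d : nth IHalt P pc = ISub a b d ->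
  reach P (pc.+1, upd m d (m a - m b)) T s' -> reach P (pc, m) T.+1 s'.
Proof. by move=> e; apply: reach_step; rewrite /step e. Qed.

Lemma reach_mul a b d : nth IHalt P pc = IMul a b d ->
  reach P (pc.+1, upd m d (m a * m b)) T s' -> reach P (pc, m) T.+1 s'.
Proof. by move=> e; apply: reach_step; rewrite /step e. Qed.

Lemma addr_nat k : addr k%:R = Some k.
Proof. by rewrite /addr natr_nat natrK. Qed.

Lemma reach_load a d k : nth IHalt P pc = ILoad a d -> m a = k%:R ->
  reach P (pc.+1, upd m d (m k)) T s' -> reach P (pc, m) T.+1 s'.
Proof. by move=> e ea; apply: reach_step; rewrite /step e ea addr_nat. Qed.

Lemma reach_store a d k : nth IHalt P pc = IStore a d -> m d = k%:R ->
  reach P (pc.+1, upd m k (m a)) T s' -> reach P (pc, m) T.+1 s'.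
Proof. by move=> e ea; apply: reach_step; rewrite /step e ea addr_nat. Qed.

Lemma reach_jlt a b l : nth IHalt P pc = IJlt a b l ->
  reach P (if m a < m b then l else pc.+1, m) T s' -> reach P (pc, m) T.+1 s'.
Proof. by move=> e; apply: reach_step; rewrite /step e. Qed.

Lemma reach_jmp l : nth IHalt P pc = IJmp l ->
  reach P (l, m) T s' -> reach P (pc, m) T.+1 s'.
Proof. by move=> e; apply: reach_step; rewrite /step e. Qed.

End Steps.

(** * A loop language over rational arrays *)

(** Index expressions have neither subtraction nor array reads, so every computed address is a
    natural number and no indirect access can get stuck. *)
Inductive nexp := NVar of nat | NConst of nat | NAdd of nexp & nexp | NMul of nexp & nexp.

Inductive rexp :=
| RConst of rat | RNat of nexp | RArr of nat & nexp
| RAdd of rexp & rexp | RSub of rexp & rexp | RMul of rexp & rexp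
| RLt of rexp & rexp.

(* [For v b c] binds variable [v] to the values below that of variable [b].
   [Find v b e c] binds [v] to the last value [i] of [v.+1] below [b] at which
   [e] is positive ([0] if there is none). *)
Inductive cmd :=
| Skip
| Set_ of nat & nexp & rexp
| Seq of cmd & cmd
| If of rexp & cmd & cmd
| For of nat & nat & cmd
| Find of nat & nat & rexp & cmd.

Definition env := nat -> nat.
Definition arrays := nat -> nat -> rat.

Definition bind (r : env) (v x : nat) : env := fun w => if w == v then x else r w.
Definition setA (s : arrays) (f i : nat) (q : rat) : arrays :=
  fun g j => if (g == f) && (j == i) then q else s g j.

Fixpoint neval (r : env) (e : nexp) : nat :=
  match e with
  | NVar v => r v
  | NConst c => c
  | NAdd a b => neval r a + neval r b
  | NMul a b => neval r a * neval r b
  end.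

Fixpoint reval (r : env) (s : arrays) (e : rexp) : rat :=
  match e with
  | RConst q => q
  | RNat e => (neval r e)%:R
  | RArr f e => s f (neval r e)
  | RAdd a b => reval r s a + reval r s b
  | RSub a b => reval r s a - reval r s b
  | RMul a b => reval r s a * reval r s b
  | RLt a b => ((reval r s a < reval r s b)%R : nat)%:R
  end.

Definition loop (body : nat -> arrays -> arrays) (k : nat) (s : arrays) : arrays :=
  foldl (fun s i => body i s) s (iota 0 k).

(** The predicate also receives the current candidate, because the test of [Find] is evaluated with
    [v] bound to it. *)
Definition find_last (p : nat -> nat -> bool) (k : nat) : nat :=
  foldl (fun x i => if p x i then i else x) 0%N (iota 0 k).

Fixpoint eval (c : cmd) (r : env) (s : arrays) : arrays :=
  match c with
  | Skip => s
  | Set_ f e q => setA s f (neval r e) (reval r s q)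
  | Seq c1 c2 => eval c2 r (eval c1 r s)
  | If e c1 c2 => if 0 < reval r s e then eval c1 r s else eval c2 r s
  | For v b c => loop (fun i => eval c (bind r v i)) (r b) s
  | Find v b e c =>
      eval c (bind r v (find_last
        (fun x i => 0 < reval (bind (bind r v x) v.+1 i) s e) (r b))) s
  end.

Lemma loopS body k s : loop body k.+1 s = body k (loop body k s).
Proof. by rewrite /loop -[k.+1]addn1 iotaD foldl_cat. Qed.

Lemma find_lastS p k :
  find_last p k.+1 = if p (find_last p k) k then k else find_last p k.
Proof. by rewrite /find_last -[k.+1]addn1 iotaD foldl_cat. Qed.

(** * Compilation to the random access machine *)

(* Cells [0] and [1] are unused by compiled code, cell [2] holds the base
   address [B], cell [3 + v] holds variable [v], cells [TMP .. NREG - 1] are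
   temporaries, and entry [i] of array [f] lives in cell [B + i * NARR + f]. *)
Definition NARR := 24%N.
Definition NREG := 40%N.
Definition TMP := 12%N.

Section Compile.
Local Notation tmp t := (TMP + t)%N.

Fixpoint compN (e : nexp) (t : nat) : seq instr :=
  match e with
  | NVar v => [:: IConst 0 (tmp t); IAdd (3 + v) (tmp t) (tmp t)]
  | NConst c => [:: IConst c%:R (tmp t)]
  | NAdd a b => compN a t ++ compN b t.+1 ++ [:: IAdd (tmp t) (tmp t.+1) (tmp t)]
  | NMul a b => compN a t ++ compN b t.+1 ++ [:: IMul (tmp t) (tmp t.+1) (tmp t)]
  end.

Definition comp_addr (f : nat) (e : nexp) (t : nat) : seq instr :=
  compN e t ++ [:: IConst NARR%:R (tmp t.+1); IMul (tmp t) (tmp t.+1) (tmp t);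
    IConst f%:R (tmp t.+1); IAdd (tmp t) (tmp t.+1) (tmp t);
    IAdd 2 (tmp t) (tmp t)].

(** Comparisons compile to jumps, whose targets are absolute; hence the argument [pc], the address
    at which the code will be placed. *)
Fixpoint compR (e : rexp) (t pc : nat) : seq instr :=
  let bin a b op :=
    let ca := compR a t pc in
    ca ++ compR b t.+1 (pc + size ca) ++ [:: op (tmp t) (tmp t.+1) (tmp t)] in
  match e with
  | RConst q => [:: IConst q (tmp t)]
  | RNat e => compN e t
  | RArr f e => comp_addr f e t ++ [:: ILoad (tmp t) (tmp t)]
  | RAdd a b => bin a b IAdd
  | RSub a b => bin a b ISub
  | RMul a b => bin a b IMul
  | RLt a b =>
      let ca := compR a t pc in
      let cb := compR b t.+1 (pc + size ca) in
      let l := (pc + size ca + size cb)%N in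
      ca ++ cb ++ [:: IJlt (tmp t) (tmp t.+1) (l + 3); IConst 0 (tmp t);
        IJmp (l + 4); IConst 1 (tmp t)]
  end.

Fixpoint compC (c : cmd) (pc : nat) : seq instr :=
  match c with
  | Skip => [::]
  | Set_ f e q =>
      let ca := comp_addr f e 0 in
      ca ++ compR q 1 (pc + size ca) ++ [:: IStore (tmp 1) (tmp 0)]
  | Seq c1 c2 => let k1 := compC c1 pc in k1 ++ compC c2 (pc + size k1)
  | If e c1 c2 =>
      let ke := compR e 0 pc in
      let l := (pc + size ke + 2)%N in
      let k2 := compC c2 l in
      let l1 := (l + size k2 + 1)%N in
      let k1 := compC c1 l1 in
      ke ++ [:: IConst 0 (tmp 1); IJlt (tmp 1) (tmp 0) l1] ++
      k2 ++ [:: IJmp (l1 + size k1)] ++ k1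
  | For v b c =>
      let k := compC c (pc + 3) in
      [:: IConst 0 (3 + v); IJlt (3 + v) (3 + b) (pc + 3);
          IJmp (pc + 3 + size k + 3)] ++
      k ++ [:: IConst 1 (tmp 0); IAdd (3 + v) (tmp 0) (3 + v); IJmp (pc + 1)]
  | Find v b e c =>
      let ke := compR e 0 (pc + 4) in
      let l := (pc + 4 + size ke)%N in
      [:: IConst 0 (3 + v); IConst 0 (3 + v.+1);
          IJlt (3 + v.+1) (3 + b) (pc + 4); IJmp (l + 7)] ++
      ke ++ [:: IConst 0 (tmp 1); IJlt (tmp 1) (tmp 0) (l + 3); IJmp (l + 4);
        IAdd (3 + v.+1) (tmp 1) (3 + v); IConst 1 (tmp 0);
        IAdd (3 + v.+1) (tmp 0) (3 + v.+1); IJmp (pc + 2)] ++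
      compC c (l + 7)
  end.

(** * Scoping and cost of programs *)

Fixpoint nwf (d : nat) (e : nexp) (t : nat) : bool :=
  match e with
  | NVar v => (v < d) && (tmp t.+1 < NREG)
  | NConst _ => tmp t.+1 < NREG
  | NAdd a b | NMul a b => nwf d a t && nwf d b t.+1
  end%N.

Fixpoint rwf (d : nat) (e : rexp) (t : nat) : bool :=
  match e with
  | RConst _ => tmp t < NREG
  | RNat e => nwf d e t
  | RArr f e => (f < NARR) && nwf d e t
  | RAdd a b | RSub a b | RMul a b | RLt a b => rwf d a t && rwf d b t.+1
  end%N.

(** Variables are numbered by nesting depth, [d] of them being in scope. Only variables 0 and 1,
    which hold [n] and [N], may bound a loop, so that costs can be bounded statically; [v < 9] keeps
    the cell [3 + v] below the temporaries. *)
Fixpoint cwf (d : nat) (c : cmd) : bool :=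
  match c with
  | Skip => true
  | Set_ f e q => [&& f < NARR, nwf d e 0 & rwf d q 1]
  | Seq c1 c2 => cwf d c1 && cwf d c2
  | If e c1 c2 => [&& rwf d e 0, cwf d c1 & cwf d c2]
  | For v b c => [&& v == d, b < 2, v < 9 & cwf d.+1 c]
  | Find v b e c => [&& v == d, b < 2, v.+1 < 9, rwf d.+2 e 0 & cwf d.+1 c]
  end%N.

Fixpoint ncost (e : nexp) : nat :=
  match e with
  | NVar _ => 2 | NConst _ => 1
  | NAdd a b | NMul a b => ncost a + (ncost b + 1)
  end.

Fixpoint rcost (e : rexp) : nat :=
  match e with
  | RConst _ => 1
  | RNat e => ncost e
  | RArr _ e => ncost e + 6
  | RAdd a b | RSub a b | RMul a b => rcost a + (rcost b + 1)
  | RLt a b => rcost a + (rcost b + 3)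
  end.

Fixpoint ccost (N : nat) (c : cmd) : nat :=
  match c with
  | Skip => 0
  | Set_ f e q => ncost e + 5 + (rcost q + 1)
  | Seq c1 c2 => ccost N c1 + ccost N c2
  | If e c1 c2 => rcost e + (2 + (ccost N c1 + ccost N c2 + 1))
  | For v b c => 1 + (N * (ccost N c + 4) + 2)
  | Find v b e c => 2 + (N * (rcost e + 7) + 2 + ccost N c)
  end.

Fixpoint depth (c : cmd) : nat :=
  match c with
  | Skip | Set_ _ _ _ => 0
  | Seq c1 c2 | If _ c1 c2 => maxn (depth c1) (depth c2)
  | For _ _ c => (depth c).+1
  | Find _ _ _ c => maxn 1 (depth c)
  end.

(** The cost is a polynomial in [N] with nonnegative coefficients and of degree at most [depth c].
    For positive [N] it is thus at most the sum of its coefficients, which is its value at 1, times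
    the highest power. *)
Lemma ccost_poly N c : (0 < N)%N -> (ccost N c <= ccost 1 c * N ^ depth c)%N.
Proof.
move=> N0.
have pos k : (0 < N ^ k)%N by rewrite expn_gt0 N0.
have mono a b k : (a <= b)%N -> (k * N ^ a <= k * N ^ b)%N.
  by move=> le; rewrite leq_mul2l leq_pexp2l ?orbT.
elim: c => //=.
- by move=> f e q; rewrite expn0 muln1.
- move=> c1 IH1 c2 IH2; rewrite mulnDl; apply: leq_add.
    by apply: leq_trans IH1 _; apply: mono; rewrite leq_maxl.
  by apply: leq_trans IH2 _; apply: mono; rewrite leq_maxr.
- move=> e c1 IH1 c2 IH2.
  have := leq_trans IH1 (mono _ _ _ (leq_maxl _ (depth c2))).
  have := leq_trans IH2 (mono _ _ _ (leq_maxr (depth c1) _)).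
  have := pos (maxn (depth c1) (depth c2)).
  set X := (N ^ _)%N; nia.
- move=> v b c IH; rewrite expnS; have := pos (depth c).
  set X := (N ^ _)%N in IH *; nia.
- move=> v b e c IH.
  have := leq_trans IH (mono _ _ _ (leq_maxr 1 (depth c))).
  have : (N <= N ^ maxn 1 (depth c))%N.
    by rewrite -[X in (X <= _)%N]expn1 leq_pexp2l // leq_maxl.
  set X := (N ^ _)%N; nia.
Qed.

(** * Correctness of the compilation *)

Definition rep (d B : nat) (r : env) (s : arrays) (m : memory) : Prop :=
  [/\ (d <= 9)%N, (NREG <= B)%N, m 2%N = B%:R,
      forall v, (v < d)%N -> m (3 + v)%N = (r v)%:R &
      forall f i, (f < NARR)%N -> m (B + i * NARR + f)%N = s f i].

(** The second operand of an operation is compiled with [t.+1]; this is what protects the value of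
    the first operand, left in temporary [t]. *)
Definition frame (t : nat) (m m' : memory) : Prop :=
  forall p, (p < tmp t)%N || (NREG <= p)%N -> m' p = m p.

Lemma frame_trans t m1 m2 m3 : frame t m1 m2 -> frame t m2 m3 -> frame t m1 m3.
Proof. by move=> h1 h2 p hp; rewrite h2 // h1. Qed.

Lemma frame_weak t t' m m' : (t <= t')%N -> frame t' m m' -> frame t m m'.
Proof. by move=> le h p hp; apply: h; lia. Qed.

Lemma frame_upd t d q m : (tmp t <= d < NREG)%N -> frame t m (upd m d q).
Proof. by move=> hd p hp; rewrite /upd; case: eqP => // e; lia. Qed.

Lemma rep_frame d B r s t m m' : frame t m m' -> rep d B r s m -> rep d B r s m'.
Proof.
move=> h [h1 h2 h3 h4 h5]; split=> //.
- by rewrite h.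
- by move=> v hv; rewrite h ?h4 //; rewrite /TMP; lia.
- by move=> f i hf; rewrite h ?h5 //; apply/orP; right; lia.
Qed.

Lemma updE m d q p : upd m d q p = if p == d then q else m p.
Proof. by []. Qed.

Lemma upd_same m d q : upd m d q d = q.
Proof. by rewrite /upd eqxx. Qed.

Lemma upd_other m d q p : p <> d -> upd m d q p = m p.
Proof. by rewrite /upd; case: eqP. Qed.

Lemma nwf_tmp d e t : nwf d e t -> (tmp t.+1 < NREG)%N.
Proof. by elim: e => [v|c|a IH b _|a IH b _] //= /andP[] // /IH. Qed.

Lemma rwf_tmp d e t : rwf d e t -> (tmp t < NREG)%N.
Proof.
have nw e' : nwf d e' t -> (tmp t < NREG)%N by move/nwf_tmp; lia.
elim: e => [q|e'|f e'|a IH b _|a IH b _|a IH b _|a IH b _] //=.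
- exact: nw.
- by move=> /andP[_ /nw].
all: by move=> /andP[/IH].
Qed.

Section Correct.
Variables (P : seq instr) (B N : nat).

Lemma compN_ok e t pc d r s m :
  code_at P pc (compN e t) -> nwf d e t -> rep d B r s m ->
  exists m', [/\ reach P (pc, m) (ncost e) (pc + size (compN e t), m')%N,
    m' (tmp t) = (neval r e)%:R & frame t m m'].
Proof.
elim: e t pc m => [v|c|a IHa b IHb|a IHa b IHb] t pc m /=.
- move=> [c1 [c2 _]] /andP[vd tw] [d9 _ _ mv _].
  set m1 := upd m (tmp t) 0; exists (upd m1 (tmp t) (r v)%:R); split.
  + apply: (reach_const c1); apply: (reach_add c2).
    rewrite upd_same upd_other ?(mv _ vd) ?addr0; last by rewrite /TMP; lia.
    by rewrite addn2; apply: reach_refl.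
  + by rewrite upd_same.
  + by apply: (@frame_trans _ _ m1); apply: frame_upd; lia.
- move=> [c1 _] tw _; exists (upd m (tmp t) c%:R); split.
  + by apply: (reach_const c1); rewrite addn1; apply: reach_refl.
  + by rewrite upd_same.
  + by apply: frame_upd; lia.
- rewrite !code_at_cat => -[ca [cb [cc _]]] /andP[wa wb] rm.
  have [m1 [r1 v1 f1]] := IHa _ _ _ ca wa rm.
  have [m2 [r2 v2 f2]] := IHb _ _ _ cb wb (rep_frame f1 rm).
  have tw : (tmp t.+1 < NREG)%N by have := nwf_tmp wb; lia.
  exists (upd m2 (tmp t) (m2 (tmp t) + m2 (tmp t.+1))); split.
  + rewrite !size_cat /= !addnA; apply: reach_trans (reach_trans r1 r2) _; apply: (reach_add cc).
    by rewrite addn1; apply: reach_refl.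
  + by rewrite upd_same v2 f2 ?v1 ?natrD //; lia.
  + apply: frame_trans f1 _; apply: frame_trans (frame_weak _ f2) _ => //.
    by apply: frame_upd; lia.
- rewrite !code_at_cat => -[ca [cb [cc _]]] /andP[wa wb] rm.
  have [m1 [r1 v1 f1]] := IHa _ _ _ ca wa rm.
  have [m2 [r2 v2 f2]] := IHb _ _ _ cb wb (rep_frame f1 rm).
  have tw : (tmp t.+1 < NREG)%N by have := nwf_tmp wb; lia.
  exists (upd m2 (tmp t) (m2 (tmp t) * m2 (tmp t.+1))); split.
  + rewrite !size_cat /= !addnA; apply: reach_trans (reach_trans r1 r2) _; apply: (reach_mul cc).
    by rewrite addn1; apply: reach_refl.
  + by rewrite upd_same v2 f2 ?v1 ?natrM //; lia.
  + apply: frame_trans f1 _; apply: frame_trans (frame_weak _ f2) _ => //.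
    by apply: frame_upd; lia.
Qed.

Lemma comp_addr_ok f e t pc d r s m :
  code_at P pc (comp_addr f e t) -> nwf d e t -> rep d B r s m ->
  exists m', [/\ reach P (pc, m) (ncost e + 5) (pc + size (comp_addr f e t), m')%N,
    m' (tmp t) = (B + neval r e * NARR + f)%:R & frame t m m'].
Proof.
rewrite /comp_addr code_at_cat => -[ca /= [c1 [c2 [c3 [c4 [c5 _]]]]]] we rm.
have tw := nwf_tmp we.
have [m1 [r1 v1 f1]] := compN_ok ca we rm.
have [_ _ mB _ _] := rep_frame f1 rm.
set m2 := upd m1 (tmp t.+1) NARR%:R.
set m3 := upd m2 (tmp t) (m2 (tmp t) * m2 (tmp t.+1)).
set m4 := upd m3 (tmp t.+1) f%:R.
set m5 := upd m4 (tmp t) (m4 (tmp t) + m4 (tmp t.+1)).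
set m6 := upd m5 (tmp t) (m5 2%N + m5 (tmp t)).
exists m6; split.
- rewrite size_cat /= addnA; apply: reach_trans r1 _.
  apply: (reach_const c1); apply: (reach_mul c2); apply: (reach_const c3).
  apply: (reach_add c4); apply: (reach_add c5).
  by rewrite !addnS addn0; apply: reach_refl.
- have n1 : tmp t <> tmp t.+1 by lia.
  have n2 : 2%N <> tmp t by rewrite /TMP; lia.
  have n3 : 2%N <> tmp t.+1 by rewrite /TMP; lia.
  rewrite /m6 upd_same /m5 upd_same (upd_other _ _ n2) /m4 upd_same.
  rewrite (upd_other _ _ n1) (upd_other _ _ n3) /m3 upd_same (upd_other _ _ n2).
  rewrite /m2 upd_same (upd_other _ _ n1) (upd_other _ _ n3) v1 mB.
  by rewrite -natrM -!natrD addnA.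
- apply: frame_trans f1 _.
  apply: (@frame_trans _ _ m2); first by apply: frame_upd; lia.
  apply: (@frame_trans _ _ m3); first by apply: frame_upd; lia.
  apply: (@frame_trans _ _ m4); first by apply: frame_upd; lia.
  by apply: (@frame_trans _ _ m5); apply: frame_upd; lia.
Qed.

Lemma compR_ok e t pc d r s m :
  code_at P pc (compR e t pc) -> rwf d e t -> rep d B r s m ->
  exists m', [/\ reach P (pc, m) (rcost e) (pc + size (compR e t pc), m')%N,
    m' (tmp t) = reval r s e & frame t m m'].
Proof.
elim: e t pc m => [q|e|f e|a IHa b IHb|a IHa b IHb|a IHa b IHb|a IHa b IHb] t pc m /=.
- move=> [c1 _] tw _; exists (upd m (tmp t) q); split.
  + by apply: (reach_const c1); rewrite addn1; apply: reach_refl.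
  + by rewrite upd_same.
  + by apply: frame_upd; lia.
- exact: compN_ok.
- rewrite code_at_cat => -[ca [/= cl _]] /andP[fw ew] rm.
  have [m1 [r1 v1 f1]] := comp_addr_ok ca ew rm.
  have [_ _ _ _ ma] := rep_frame f1 rm.
  exists (upd m1 (tmp t) (m1 (B + neval r e * NARR + f)%N)); split.
  + rewrite -[6%N]/(5 + 1)%N size_cat !addnA; apply: reach_trans r1 _.
    by apply: (reach_load cl v1); rewrite addn1; apply: reach_refl.
  + by rewrite upd_same ma.
  + apply: frame_trans f1 _; apply: frame_upd.
    by have := nwf_tmp ew; lia.
- rewrite !code_at_cat => -[ca [cb [cc _]]] /andP[wa wb] rm.
  have [m1 [r1 v1 f1]] := IHa _ _ _ ca wa rm.
  have [m2 [r2 v2 f2]] := IHb _ _ _ cb wb (rep_frame f1 rm).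
  have tw : (tmp t < NREG)%N := rwf_tmp wa.
  exists (upd m2 (tmp t) (m2 (tmp t) + m2 (tmp t.+1))); split.
  + rewrite !size_cat /= !addnA; apply: reach_trans (reach_trans r1 r2) _; apply: (reach_add cc).
    by rewrite addn1; apply: reach_refl.
  + by rewrite upd_same v2 f2 ?v1 //; lia.
  + apply: frame_trans f1 _; apply: frame_trans (frame_weak _ f2) _ => //.
    by apply: frame_upd; lia.
- rewrite !code_at_cat => -[ca [cb [cc _]]] /andP[wa wb] rm.
  have [m1 [r1 v1 f1]] := IHa _ _ _ ca wa rm.
  have [m2 [r2 v2 f2]] := IHb _ _ _ cb wb (rep_frame f1 rm).
  have tw : (tmp t < NREG)%N := rwf_tmp wa.
  exists (upd m2 (tmp t) (m2 (tmp t) - m2 (tmp t.+1))); split.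
  + rewrite !size_cat /= !addnA; apply: reach_trans (reach_trans r1 r2) _; apply: (reach_sub cc).
    by rewrite addn1; apply: reach_refl.
  + by rewrite upd_same v2 f2 ?v1 //; lia.
  + apply: frame_trans f1 _; apply: frame_trans (frame_weak _ f2) _ => //.
    by apply: frame_upd; lia.
- rewrite !code_at_cat => -[ca [cb [cc _]]] /andP[wa wb] rm.
  have [m1 [r1 v1 f1]] := IHa _ _ _ ca wa rm.
  have [m2 [r2 v2 f2]] := IHb _ _ _ cb wb (rep_frame f1 rm).
  have tw : (tmp t < NREG)%N := rwf_tmp wa.
  exists (upd m2 (tmp t) (m2 (tmp t) * m2 (tmp t.+1))); split.
  + rewrite !size_cat /= !addnA; apply: reach_trans (reach_trans r1 r2) _; apply: (reach_mul cc).
    by rewrite addn1; apply: reach_refl.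
  + by rewrite upd_same v2 f2 ?v1 //; lia.
  + apply: frame_trans f1 _; apply: frame_trans (frame_weak _ f2) _ => //.
    by apply: frame_upd; lia.
- rewrite !code_at_cat => -[ca [cb [cj [c0 [cm [c1 _]]]]]] /andP[wa wb] rm.
  have [m1 [r1 v1 f1]] := IHa _ _ _ ca wa rm.
  have [m2 [r2 v2 f2]] := IHb _ _ _ cb wb (rep_frame f1 rm).
  have tw : (tmp t < NREG)%N := rwf_tmp wa.
  exists (upd m2 (tmp t) ((reval r s a < reval r s b)%R : nat)%:R); split.
  + rewrite !size_cat /= !addnA; apply: reach_trans (reach_trans r1 r2) _; apply: (reach_jlt cj).
    rewrite v2 f2 ?v1; last lia.
    case: ifP => lt /=.
      by rewrite addn3; apply: (reach_const c1); rewrite !addnS addn0; apply: reach_refl.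
    by apply: (reach_const c0); apply: (reach_jmp cm); apply: reach_refl.
  + by rewrite upd_same.
  + apply: frame_trans f1 _; apply: frame_trans (frame_weak _ f2) _ => //.
    by apply: frame_upd; lia.
Qed.

Lemma rep_weak d d' r s m : (d' <= d)%N -> rep d B r s m -> rep d' B r s m.
Proof.
by move=> le [h1 h2 h3 h4 h5]; split=> // [|v hv]; [lia | apply: h4; lia].
Qed.

Lemma rep_upd_var d r s m v x : (d < 9)%N -> v = d ->
  rep d B r s m -> rep d.+1 B (bind r v x) s (upd m (3 + v) x%:R).
Proof.
move=> d9 -> [h1 h2 h3 h4 h5]; split=> //.
- move=> w hw; rewrite /bind; case: eqP => [->|ne]; first by rewrite upd_same.
  by rewrite upd_other ?h4 //; lia.
- move=> f i hf; rewrite upd_other ?h5 //.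
  by move: h2; rewrite /NREG; lia.
Qed.

Lemma rep_unbind d r s m v x : (d <= v)%N -> rep d B (bind r v x) s m -> rep d B r s m.
Proof.
move=> le [h1 h2 h3 h4 h5]; split=> // w hw.
by have := h4 w hw; rewrite /bind; case: eqP => // e; lia.
Qed.

Lemma rep_set_var d r r' s m w x : (w < d)%N -> r' =1 bind r w x ->
  rep d B r s m -> rep d B r' s (upd m (3 + w) x%:R).
Proof.
move=> wd er [h1 h2 h3 h4 h5]; split=> //.
- move=> u hu; rewrite er /bind; case: eqP => [->|ne]; first by rewrite upd_same.
  by rewrite upd_other ?h4 //; lia.
- move=> f i hf; rewrite upd_other ?h5 //.
  by move: h2; rewrite /NREG; lia.
Qed.

Lemma comp_ok c pc d r s m :
  code_at P pc (compC c pc) -> cwf d c -> (2 <= d)%N ->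
  (r 0 <= N)%N -> (r 1 <= N)%N -> rep d B r s m ->
  exists2 m', reach P (pc, m) (ccost N c) (pc + size (compC c pc), m')%N &
    rep d B r (eval c r s) m'.
Proof.
elim: c pc d r s m => [|f e q|c1 IH1 c2 IH2|e c1 IH1 c2 IH2|v b c IH|v b e c IH]
  pc d r s m.
- by move=> _ _ _ _ _ rm; exists m => //=; rewrite addn0; apply: reach_refl.
- move=> /= /code_at_cat[ca /code_at_cat[cq [/= cs _]]] /and3P[fw ew qw] _ _ _ rm.
  have [m1 [r1 v1 f1]] := comp_addr_ok ca ew rm.
  have [m2 [r2 v2 f2]] := compR_ok cq qw (rep_frame f1 rm).
  have v3 : m2 (tmp 0) = (B + neval r e * NARR + f)%:R by rewrite f2 ?v1.
  exists (upd m2 (B + neval r e * NARR + f) (m2 (tmp 1))).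
    rewrite (size_cat (comp_addr f e 0)) (size_cat (compR _ _ _)) /= !addnA.
    apply: reach_trans (reach_trans r1 r2) _.
    by apply: (reach_store cs v3); apply: reach_done; rewrite addn1.
  have [h1 h2 h3 h4 h5] := rep_frame f2 (rep_frame f1 rm).
  split=> //.
  + by rewrite upd_other //; move: h2; rewrite /NREG; lia.
  + by move=> v vd; rewrite upd_other ?h4 //; move: h2; rewrite /NREG; lia.
  + move=> g i gw; rewrite /setA updE v2 h5 //.
    (* Both array numbers are below the stride [NARR], so a cell determines its array and its entry,
       as in division with remainder. *)
    suff -> : (B + i * NARR + g == B + neval r e * NARR + f)%N =
             (g == f) && (i == neval r e) by [].
    by move: fw gw; rewrite /NARR => fw gw; apply/idP/idP; lia.
- move=> /=; rewrite code_at_cat => -[k1 k2] /andP[w1 w2] d2 n1 n2 rm.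
  have [m1 r1 rm1] := IH1 _ _ _ _ _ k1 w1 d2 n1 n2 rm.
  have [m2 r2 rm2] := IH2 _ _ _ _ _ k2 w2 d2 n1 n2 rm1.
  by exists m2 => //; rewrite size_cat addnA; apply: reach_trans r1 r2.
- rewrite [compC _ _]/=; set ke := compR e 0 pc; set l := (pc + size ke + 2)%N.
  set k2 := compC c2 l; set l1 := (l + size k2 + 1)%N; set k1 := compC c1 l1.
  have E : (pc + size ke).+2 = l by rewrite /l addn2.
  have E1 : (l + size k2).+1 = l1 by rewrite /l1 addn1.
  move=> /= /code_at_cat[hke [i1 [i2 /code_at_cat[]]]].
  rewrite E => hk2 [i3]; rewrite E1 => hk1 /and3P[ew w1 w2] d2 n1 n2 rm.
  have [m1 [r1 v1 f1]] := compR_ok hke ew rm.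
  set m2 := upd m1 (tmp 1) 0.
  have f12 : frame 1 m1 m2 by apply: frame_upd; rewrite /TMP /NREG.
  have rm2 := rep_frame f12 (rep_frame f1 rm).
  have v2 : m2 (tmp 0) = reval r s e by rewrite f12.
  have v3 : m2 (tmp 1) = 0 by rewrite /m2 upd_same.
  have -> : (pc + size (ke ++ [:: IConst 0 (tmp 1), IJlt (tmp 1) (tmp 0) l1 &
     k2 ++ IJmp (l1 + size k1) :: k1]) = l1 + size k1)%N.
    by rewrite /l1 /l !size_cat /= size_cat /=; lia.
  have start T s' : reach P (if 0 < reval r s e then l1 else l, m2) T s' ->
    reach P (pc, m) (rcost e + (2 + T)) s'.
    move=> h; apply: reach_trans r1 _.
    apply: (reach_const i1); apply: (reach_jlt i2); rewrite -/m2 v2 v3.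
    by rewrite -addn2 -/l.
  case: ifP start => lt start.
  + have [m3 r3 rm3] := IH1 _ _ _ _ _ hk1 w1 d2 n1 n2 rm2.
    by exists m3 => //; apply: start; apply: reach_le r3 _; lia.
  + have [m3 r3 rm3] := IH2 _ _ _ _ _ hk2 w2 d2 n1 n2 rm2.
    exists m3 => //; apply: start.
    apply: reach_le (_ : reach P _ (ccost N c2 + 1) _) _; last lia.
    by apply: reach_trans r3 _; apply: (reach_jmp i3); apply: reach_refl.
- rewrite [compC _ _]/=; set k := compC c (pc + 3).
  have -> : (pc + size [:: IConst 0 (3 + v), IJlt (3 + v) (3 + b) (pc + 3),
     IJmp (pc + 3 + size k + 3) & k ++ [:: IConst 1 (tmp 0);
     IAdd (3 + v) (tmp 0) (3 + v); IJmp (pc + 1)]] = pc + 3 + size k + 3)%N.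
    by rewrite /= size_cat /=; lia.
  set lend := (pc + 3 + size k + 3)%N.
  move=> /= [i1 [i2 [i3 /code_at_cat[]]]]; rewrite -[pc.+3]addn3 => hk [i4 [i5 [i6 _]]] /and4P[/eqP vd b2 v9 cw] d2 n1 n2 rm.
  have bN : (r b <= N)%N by case: b b2 {i2} => [|[|]].
  set body := fun i => eval c (bind r v i).
  (* The invariant before the test of round [i], stated in the scope of the body. After the loop the
     counter keeps its last value in its cell but falls out of scope. *)
  pose I i m := rep d.+1 B (bind r v i) (loop body i s) m.
  have I0 : I 0%N (upd m (3 + v) 0) by apply: rep_upd_var; rewrite // -vd.
  have [i m1 ib rm1|m' r' rm'] :=
      @reach_iter P I (r b) (ccost N c + 4) pc.+1 _ _ I0.
    have /= := IH (pc + 3)%N d.+1 (bind r v i) (loop body i s) m1 hk.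
    have bv j : (j < 2)%N -> bind r v i j = r j.
      by rewrite /bind; case: eqP => // e; lia.
    rewrite !bv // => /(_ cw (ltnW d2) n1 n2 rm1) [m2 r2 rm2].
    set m3 := upd m2 (tmp 0) 1.
    have f3 : frame 0 m2 m3 by apply: frame_upd; rewrite /TMP /NREG.
    have rm3 := rep_frame f3 rm2.
    have v3 : m3 (3 + v)%N = i%:R.
      by case: rm3 => _ _ _ h _; rewrite h ?vd // /bind -vd eqxx.
    exists (upd m3 (3 + v) i.+1%:R).
      rewrite -[4%N]/(1 + 3)%N addnA [(_ + 1)%N]addnC.
      apply: reach_trans (reach_trans _ r2) _.
        apply: (reach_jlt i2); case: rm1 => _ _ _ h _; rewrite !h; try lia.
        rewrite (bv b) // {1}/bind eqxx ltr_nat ib; exact: reach_refl.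
      apply: (reach_const i4); apply: (reach_add i5); rewrite -/m3 v3.
      have -> : m3 (tmp 0) = 1 by rewrite /m3 upd_same.
      by rewrite -natr1 -[pc.+1]addn1; apply: (reach_jmp i6); apply: reach_refl.
    rewrite /I loopS; apply: rep_upd_var => //; first by rewrite -vd.
    by apply: (@rep_unbind _ _ _ _ v i); [lia | apply: rep_weak rm3].
  exists m'; last by apply: (@rep_unbind _ _ _ _ v (r b)); [lia | apply: rep_weak rm'].
  apply: reach_le (_ : reach P _ (1 + (r b * (ccost N c + 4) + 2)) _) _; last first.
    by rewrite /= leq_add2l leq_add2r leq_mul2r bN orbT.
  apply: (reach_const i1); apply: reach_trans r' _; apply: (reach_jlt i2).
  case: rm' => _ _ _ h _; rewrite !h; try lia.
  rewrite /bind eqxx; have -> : (b == v) = false by lia.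
  by rewrite ltxx; apply: (reach_jmp i3); apply: reach_refl.
- rewrite [compC _ _]/=; set ke := compR e 0 (pc + 4).
  set l := (pc + 4 + size ke)%N; set k := compC c (l + 7).
  move=> /= [i1 [i2 [i3 [i4 /code_at_cat[]]]]].
  rewrite -[pc.+4]addn4 -/l => hke [j1 [j2 [j3 [j4 [j5 [j6 [j7]]]]]]].
  rewrite -[l.+4.+3]/(7 + l)%N [(7 + l)%N]addnC => hk.
  move=> /and5P[/eqP vd b2 v9 ew cw] d2 n1 n2 rm.
  have bN : (r b <= N)%N by case: b b2 {i3} => [|[|]].
  set p := fun x i => 0 < reval (bind (bind r v x) v.+1 i) s e.
  (* The search needs two variables: the candidate [v] and the running index [v.+1]. Only [v]
     survives, and the body may use [v.+1] again for its own loops. *)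
  pose I i m := rep d.+2 B (bind (bind r v (find_last p i)) v.+1 i) s m.
  have I0 : I 0%N (upd (upd m (3 + v) 0) (3 + v.+1) 0).
    apply: rep_upd_var; rewrite -?vd //; rewrite vd.
    by apply: rep_upd_var; rewrite // -vd; lia.
  have [i m1 ib rm1|m' r' rm'] :=
      @reach_iter P I (r b) (rcost e + 7) pc.+2 _ _ I0.
    have [m2 [r2 v2 f2]] := compR_ok hke ew rm1.
    set m3 := upd m2 (tmp 1) 0.
    have f3 : frame 1 m2 m3 by apply: frame_upd; rewrite /TMP /NREG.
    have rm3 := rep_frame f3 (rep_frame f2 rm1).
    pose m4 := if p (find_last p i) i then upd m3 (3 + v) i%:R else m3.
    have rm4 : rep d.+2 B (bind (bind r v (find_last p i.+1)) v.+1 i) s m4.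
      rewrite /m4 find_lastS; case: ifP => _ //.
      apply: rep_set_var rm3; first lia.
      by move=> w; rewrite /bind; case: (w == v.+1); case: (w == v).
    set m5 := upd m4 (tmp 0) 1.
    have f5 : frame 0 m4 m5 by apply: frame_upd; rewrite /TMP /NREG.
    have rm5 := rep_frame f5 rm4.
    exists (upd m5 (3 + v.+1) i.+1%:R); last first.
      apply: rep_set_var rm5; first lia.
      by move=> w; rewrite /bind; case: (w == v.+1).
    have v5 : m5 (3 + v.+1)%N = i%:R.
      by case: rm5 => _ _ _ h _; rewrite h ?vd // /bind eqxx.
    rewrite -[7%N]/(1 + 6)%N addnA [(_ + 1)%N]addnC.
    apply: reach_trans (reach_trans _ r2) _.
      apply: (reach_jlt i3); case: rm1 => _ _ _ h _; rewrite !h; try lia.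
      rewrite {1}/bind eqxx.
      have -> : bind (bind r v (find_last p i)) v.+1 i b = r b.
        rewrite /bind; have -> : (b == v.+1) = false by lia.
        by have -> : (b == v) = false by lia.
      by rewrite ltr_nat ib; apply: reach_refl.
    apply: (reach_const j1); apply: (reach_jlt j2); rewrite -/m3.
    have -> : m3 (tmp 1) = 0 by rewrite /m3 upd_same.
    have -> : m3 (tmp 0) = m2 (tmp 0) by rewrite f3.
    rewrite v2 -/(p (find_last p i) i).
    have tail : reach P (l.+4, m4) 3 (pc.+2, upd m5 (3 + v.+1) i.+1%:R).
      apply: (reach_const j5); apply: (reach_add j6); rewrite -/m5 v5.
      have -> : m5 (tmp 0) = 1 by rewrite /m5 upd_same.
      by rewrite natr1 -[pc.+2]addn2; apply: (reach_jmp j7); apply: reach_refl.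
    rewrite /m4 in tail *; case: ifP tail => pp tail.
      (* The temporary [tmp 1] still holds the zero of the comparison, so this addition copies the
         index into the candidate. *)
      rewrite addn3; apply: (reach_add j4).
      have -> : m3 (tmp 1) = 0 by rewrite /m3 upd_same.
      suff -> : m3 (3 + v.+1)%N = i%:R by rewrite addr0.
      by case: rm3 => _ _ _ h _; rewrite h ?vd // /bind eqxx.
    by apply: (reach_jmp j3); rewrite addn4.
  set x := find_last p (r b) in rm' *.
  have rm1 : rep d.+1 B (bind r v x) s m'.
    by apply: (@rep_unbind _ _ _ _ v.+1 (r b)); [lia | apply: rep_weak rm'].
  have bv j : (j < 2)%N -> bind r v x j = r j by rewrite /bind; case: eqP => // e'; lia.
  have /= := IH (l + 7)%N d.+1 (bind r v x) s m' hk.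
  rewrite !bv // => /(_ cw (ltnW d2) n1 n2 rm1) [m2 r2 rm2].
  exists m2; last by apply: (@rep_unbind _ _ _ _ v x); [lia | apply: rep_weak rm2].
  have -> : (pc + (size (ke ++ [:: IConst 0 (tmp 1), IJlt (tmp 1) (tmp 0) (l + 3),
    IJmp (l + 4), IAdd (3 + v.+1) (tmp 1) (3 + v), IConst 1 (tmp 0),
    IAdd (3 + v.+1) (tmp 0) (3 + v.+1), IJmp (pc + 2) & k])).+4 = l + 7 + size k)%N.
    by rewrite size_cat /= /l; lia.
  apply: reach_le (_ : reach P _ (2 + (r b * (rcost e + 7) + 2 + ccost N c)) _) _; last first.
    by rewrite /= !leq_add2l !leq_add2r leq_mul2r bN orbT.
  apply: (reach_const i1); apply: (reach_const i2).
  apply: reach_trans (reach_trans r' _) r2; apply: (reach_jlt i3).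
  case: rm' => _ _ _ h _; rewrite !h; try lia.
  rewrite /bind eqxx; have -> : (b == v.+1) = false by lia.
  have -> : (b == v) = false by lia.
  by rewrite ltxx; apply: (reach_jmp i4); apply: reach_refl.
Qed.

End Correct.
End Compile.

(** * Relocating the input and the output *)

(* The input fills the low cells, so that registers have to be freed one by one:
   cell [2] is available since [|C| = |M| - n]. *)
Definition prologue : seq instr :=
  [:: IConst NREG%:R 2; IAdd 2 1 2; IMul 2 2 2; IStore 3 2; IConst NARR%:R 3] ++
  flatten [seq [:: IAdd 2 3 2; IStore p 2] | p <- iota 4 (NREG - 4)] ++
  [:: IConst NREG%:R 4; IConst 1 5; IConst NREG%:R 6; IAdd 6 1 6; IMul 6 6 6;
      IJlt 4 6 84; IJmp 89; ILoad 4 7; IAdd 2 3 2; IStore 7 2; IAdd 4 5 4; IJmp 82;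
      IConst 0 5; IAdd 5 6 2; IAdd 0 5 3; IAdd 1 5 4].

Section Prologue.
Variables (P : seq instr) (m0 : memory) (n N B : nat).
Hypothesis BB : (1600 <= B)%N.

(** The state after [q] input cells, counted from cell 3, have been copied: cells 2 to [q + 2] are
    free, the later ones still hold the input. Sources lie below [B] and targets at or above it, so
    a copy never destroys input that is still to be moved. *)
Definition saved (q : nat) (m : memory) : Prop :=
  [/\ m 0%N = n%:R, m 1%N = N%:R,
      forall f i, (f < NARR)%N -> m (B + i * NARR + f)%N =
        if (f == 0%N) && (i < q)%N then m0 (i + 3)%N else 0 &
      forall x, (q + 3 <= x < B)%N -> m x = m0 x].

Lemma saved_reg q m d x : (2 <= d < q + 3)%N -> (d < B)%N ->
  saved q m -> saved q (upd m d x).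
Proof.
move=> dq dB [h1 h2 h3 h4]; split.
- by rewrite upd_other //; lia.
- by rewrite upd_other //; lia.
- by move=> f i hf; rewrite upd_other ?h3 //; lia.
- by move=> y hy; rewrite upd_other ?h4 //; lia.
Qed.

Lemma saved_next q m : (q + 3 < B)%N ->
  saved q m -> saved q.+1 (upd m (B + q * NARR) (m (q + 3)%N)).
Proof.
move=> dB [h1 h2 h3 h4]; split.
- by rewrite upd_other //; lia.
- by rewrite upd_other //; lia.
- move=> f i hf; rewrite updE h3 //.
  case: eqP => e.
    have [-> ->] : f = 0%N /\ i = q by move: e hf; rewrite /NARR; lia.
    by rewrite ltnSn h4 //; lia.
  case: (f =P 0%N) => [f0|//] /=.
  have iq : i <> q by move=> iq; apply: e; rewrite f0 iq; lia.
  by have -> : (i < q.+1)%N = (i < q)%N by lia.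
- by move=> y hy; rewrite upd_other ?h4 //; lia.
Qed.

(** Cell 2 points to the last entry written, hence [q.-1]. *)
Definition saving q m :=
  [/\ saved q m, m 2%N = (B + q.-1 * NARR)%:R & m 3%N = NARR%:R].

Lemma saving_reg q m d x : (4 <= d < q + 3)%N -> (d < B)%N ->
  saving q m -> saving q (upd m d x).
Proof.
move=> dq dB [h1 h2 h3]; split.
- by apply: saved_reg h1; lia.
- by rewrite upd_other; [exact: h2 | lia].
- by rewrite upd_other; [exact: h3 | lia].
Qed.

Lemma saving_next q m : (0 < q)%N -> (q + 3 < B)%N -> saving q m ->
  saving q.+1 (upd (upd m 2 (B + q * NARR)%:R) (B + q * NARR) (m (q + 3)%N)).
Proof.
move=> q0 qB [h1 h2 h3]; split.
- have e : upd m 2 (B + q * NARR)%:R (q + 3)%N = m (q + 3)%N by rewrite upd_other //; lia.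
  by rewrite -e; apply: saved_next qB _; apply: saved_reg h1; lia.
- by rewrite upd_other ?upd_same //; lia.
- by rewrite !upd_other //; lia.
Qed.

Lemma saving_ptr q m : (0 < q)%N -> saving q m -> m 2%N + m 3%N = (B + q * NARR)%:R.
Proof.
by case: q => // q _ [_ -> ->]; rewrite -natrD; congr _%:R; rewrite /=; lia.
Qed.

Lemma save_regs_ok j q pc m :
  code_at P pc (flatten [seq [:: IAdd 2 3 2; IStore p 2] | p <- iota (q + 3) j]) ->
  (0 < q)%N -> (q + 3 + j <= NREG)%N -> saving q m ->
  exists2 m', reach P (pc, m) (j * 2) (pc + j * 2, m')%N & saving (q + j) m'.
Proof.
elim: j q pc m => [|j IH] q pc m /=.
  by move=> _ _ _ sv; exists m; rewrite ?addn0 //; apply: reach_refl.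
move=> [c1 [c2 c]] q0 qj sv.
have qN : (q + 3 < NREG)%N by lia.
have qB : (q + 3 < B)%N by move: qN; rewrite /NREG; lia.
have sv' := saving_next q0 qB sv.
rewrite -addSn in c.
have [||m' r' sv''] := IH q.+1 pc.+2 _ c _ _ sv'; [lia|lia|].
exists m'; last by rewrite addnS -addSn.
apply: (reach_add c1); rewrite (saving_ptr q0 sv).
apply: (reach_store c2); first by rewrite upd_same.
rewrite upd_other; last lia.
by rewrite mulSn addnA addn2.
Qed.

Definition env0 : env := fun v => if v is 0 then n else N.
Definition arrays0 : arrays := fun f i => if f is 0 then m0 (i + 3)%N else 0.

(** The base [B] is the square of [NREG + N], which lies beyond the input; the cells from [B] on are
    therefore zero and so are all arrays except array 0. The prologue starts at address 0, and its
    jump targets 82, 84 and 89 are absolute: its copy loop comes after 5 instructions, 36 pairs and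
    5 more instructions. Each pass of this loop takes 6 steps, whence [6 * B]. *)
Lemma prologue_ok :
  (NREG + N)%:R * (NREG + N)%:R = B%:R :> rat ->
  code_at P 0 prologue -> m0 0%N = n%:R -> m0 1%N = N%:R ->
  (forall p, (B <= p)%N -> m0 p = 0) ->
  exists2 m, reach P (0%N, m0) (6 * B + 90) (size prologue, m) &
    rep 2 B env0 arrays0 m.
Proof.
move=> BE hc e0 e1 eB; move: hc => /code_at_cat[[a1 [a2 [a3 [a4 [a5 _]]]]] /code_at_cat[as_]].
rewrite [size _]/= => -[b1
  [b2 [b3 [b4 [b5 [c1 [c2 [c3 [c4 [c5
  [c6 [c7 [d1 [d2 [d3 [d4 _]]]]]]]]]]]]]]]].
pose m1 := upd (upd (upd m0 2 NREG%:R) 2 (NREG + N)%:R) 2 B%:R.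
have m1E x : x <> 2%N -> m1 x = m0 x by move=> ne; rewrite /m1 !upd_other.
pose m3 := upd (upd m1 B (m0 3%N)) 3 NARR%:R.
have sv0 : saved 0 m1.
  split.
  - by rewrite m1E.
  - by rewrite m1E.
  - by move=> f i hf; rewrite andbF m1E ?eB //; lia.
  - by move=> x hx; rewrite m1E //; lia.
have sv1 : saving 1 m3.
  split.
  - apply: saved_reg; [lia|lia|].
    by have := @saved_next 0 m1; rewrite mul0n addn0 m1E //; apply=> //; lia.
  - rewrite /m3 upd_other // upd_other; last lia.
    by rewrite /m1 upd_same mul0n addn0.
  - by rewrite /m3 upd_same.
have r1 : reach P (0%N, m0) 5 (5%N, m3).
  apply: (reach_const a1); apply: (reach_add a2).
  rewrite upd_same upd_other // e1 -natrD.
  apply: (reach_mul a3); rewrite !upd_same BE.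
  rewrite -/m1.
  apply: (reach_store a4); first by rewrite /m1 upd_same.
  by rewrite m1E //; apply: (reach_const a5); apply: reach_refl.
have [//|//|m4 r2 sv2] := @save_regs_ok (NREG - 4) 1 5 m3 as_ _ _ sv1.
rewrite [(1 + _)%N]/= [(5 + _)%N]/= in r2 sv2.
pose m5 := upd (upd m4 4 NREG%:R) 5 1.
pose m6 := upd (upd (upd m5 6 NREG%:R) 6 (NREG + N)%:R) 6 B%:R.
have m6E x : (x < 4)%N || (6 < x)%N -> m6 x = m4 x.
  by move=> ne; rewrite /m6 /m5 !upd_other //; lia.
have r3 : reach P (77%N, m4) 5 (82%N, m6).
  apply: (reach_const b1); apply: (reach_const b2); apply: (reach_const b3).
  rewrite -/m5; set Y := upd m5 6 _; apply: (reach_add b4).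
  have [[_ h1 _ _] _ _] := sv2.
  have -> : Y 6%N + Y 1%N = (NREG + N)%:R.
    by rewrite /Y upd_same upd_other // /m5 !upd_other // h1 natrD.
  apply: (reach_mul b5); rewrite !upd_same BE -/Y.
  exact: reach_refl.
pose I k m := [/\ saving (NREG - 3 + k) m, m 4%N = (NREG + k)%:R, m 5%N = 1 & m 6%N = B%:R].
have I0 : I 0%N m6.
  split.
  - rewrite addn0; do 5!(apply: saving_reg; [by rewrite /NREG | lia | ]).
    exact: sv2.
  - by rewrite addn0.
  - by [].
  - by [].
have [k m kB [sk k4 k5 k6]|m7 r4 [sv7 k4 k5 k6]] :=
    @reach_iter P I (B - NREG) 6 82 _ _ I0.
  have q0 : (0 < NREG - 3 + k)%N by [].
  pose m' := upd m 7 (m (NREG + k)%N).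
  have sk' : saving (NREG - 3 + k) m'.
    by apply: saving_reg sk; rewrite /NREG; lia.
  have qB : (NREG - 3 + k + 3 < B)%N by move: kB; rewrite /NREG; lia.
  have sk1 := saving_next q0 qB sk'.
  have eq3 : (NREG - 3 + k + 3)%N = (NREG + k)%N by rewrite /NREG; lia.
  rewrite eq3 in sk1.
  set z := (B + _ * NARR)%N in sk1; set m2 := upd (upd m' _ _) _ _ in sk1.
  have zz : (8 <= z)%N by apply: leq_trans (leq_addr _ _); lia.
  have eqz : m' (NREG + k)%N = m (NREG + k)%N by rewrite /m' upd_other // /NREG; lia.
  exists (upd m2 4 (NREG + k.+1)%:R).
    apply: (reach_jlt c1); rewrite k4 k6 ltr_nat.
    have -> : (NREG + k < B)%N by lia.
    apply: (reach_load c3 k4); rewrite -/m'.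
    apply: (reach_add c4); rewrite (saving_ptr q0 sk') -/z.
    apply: (reach_store c5); first by rewrite upd_same.
    have -> : upd m' 2 z%:R 7%N = m' (NREG + k)%N by rewrite upd_other // {1}/m' upd_same.
    rewrite -/m2; apply: (reach_add c6).
    have -> : m2 4%N + m2 5%N = (NREG + k.+1)%:R.
      rewrite /m2 /m' !upd_other //; try lia.
      by rewrite k4 k5 natr1 addnS.
    by apply: (reach_jmp c7); apply: reach_refl.
  split.
  - by rewrite addnS; apply: saving_reg sk1; rewrite /NREG; lia.
  - by rewrite upd_same.
  - by rewrite upd_other // /m2 !upd_other //; lia.
  - by rewrite upd_other // /m2 !upd_other //; lia.
pose m8 := upd (upd (upd (upd m7 5 0) 2 B%:R) 3 n%:R) 4 N%:R.
exists m8.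
  apply: reach_le (_ : reach P _ (5 + 36 * 2 + 5 + (B - NREG) * 6 + 6) _) _; last lia.
  apply: reach_trans (reach_trans (reach_trans (reach_trans r1 r2) r3) r4) _.
  apply: (reach_jlt c1); rewrite k4 k6 ltr_nat.
  have -> : (NREG + (B - NREG) < B)%N = false by rewrite /NREG; lia.
  have [[h0 h1 _ _] _ _] := sv7.
  apply: (reach_jmp c2); apply: (reach_const d1); apply: (reach_add d2).
  rewrite upd_same add0r upd_other // k6.
  set x := upd _ 2 _; apply: (reach_add d3).
  have -> : x 0%N + x 5%N = n%:R by rewrite /x /upd /= h0 addr0.
  set y := upd x _ _; apply: (reach_add d4).
  have -> : y 1%N + y 5%N = N%:R by rewrite /y /x /upd /= h1 addr0.
  exact: reach_refl.
have [[_ _ h2 _] _ _] := sv7; split=> //.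
- by rewrite /NREG; lia.
- by move=> [|[|]].
- move=> f i hf; rewrite /m8 !upd_other ?h2 //; try lia.
  case: f hf => [|f] hf //=.
  case: ltnP => // le; rewrite eB //; move: le; rewrite /NREG; lia.
Qed.

End Prologue.

(** The output overwrites the registers. Cells from [NREG] on are written by a loop while registers
    are still in use; then every cell [d] from 1 to [NREG - 1] serves as its own address register.
    Cell 0, which holds the base [B + 1] of the output array, is replaced last. *)
Definition epilogue (pe : nat) : seq instr :=
  [:: IConst 1 5; IAdd 2 5 0; IConst NREG%:R 6; IConst (NREG * NARR)%:R 7;
      IAdd 0 7 7; IConst NARR%:R 8; IAdd 3 5 9;
      IJlt 6 9 (pe + 9); IJmp (pe + 14); ILoad 7 10; IStore 10 6; IAdd 6 5 6;
      IAdd 7 8 7; IJmp (pe + 7)] ++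
  flatten [seq [:: IConst (d * NARR)%:R d; IAdd 0 d d; ILoad d d] | d <- iota 1 NREG.-1] ++
  [:: ILoad 0 0].

Section Epilogue.
Variables (P : seq instr) (n B : nat) (out : nat -> rat).

Definition outmem m := m 0%N = (B + 1)%:R /\ forall i, m (B + i * NARR + 1)%N = out i.

Lemma outmem_upd m d x : (0 < d < B)%N -> outmem m -> outmem (upd m d x).
Proof.
by move=> dB [h1 h2]; split=> [|i]; rewrite upd_other ?h2 //; lia.
Qed.

Lemma load_regs_ok j d pc m :
  code_at P pc (flatten [seq [:: IConst (d * NARR)%:R d; IAdd 0 d d; ILoad d d]
    | d <- iota d j]) ->
  (0 < d)%N -> (d + j <= B)%N -> outmem m ->
  exists2 m', reach P (pc, m) (j * 3) (pc + j * 3, m')%N &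
  [/\ outmem m', forall x, (x < d)%N || (d + j <= x)%N -> m' x = m x &
      forall x, (d <= x < d + j)%N -> m' x = out x].
Proof.
elim: j d pc m => [|j IH] d pc m /=.
  move=> _ _ _ om; exists m; first by rewrite addn0; apply: reach_refl.
  by split=> // x; lia.
move=> [c1 [c2 [c3 c]]] d0 dB om.
pose m1 := upd (upd (upd m d (d * NARR)%:R) d (B + d * NARR + 1)%:R) d (out d).
have m1E x : x <> d -> m1 x = m x by move=> ne; rewrite /m1 !upd_other.
have om1 : outmem m1 by do 3!(apply: outmem_upd; first lia).
have [||m' r' [om' h1 h2]] := IH d.+1 pc.+3 m1 c _ _ om1; [lia|lia|].
exists m'.
  case: om => [e0 eo].
  apply: (reach_const c1); apply: (reach_add c2).
  rewrite upd_same upd_other ?e0 -?natrD; last lia.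
  have -> : (B + 1 + d * NARR)%N = (B + d * NARR + 1)%N by lia.
  apply: (reach_load c3); first by rewrite upd_same.
  rewrite !upd_other ?eo; try lia.
  by rewrite mulSn addnA addn3.
split=> //.
- by move=> x hx; rewrite h1 ?m1E //; lia.
- move=> x hx; case: (x =P d) => [->|ne]; last by apply: h2; lia.
  by rewrite h1 ?/m1 ?upd_same //; lia.
Qed.

Lemma epilogue_ok pe r s m :
  code_at P pe (epilogue pe) -> rep 2 B r s m -> r 0%N = n -> (n < B)%N ->
  out =1 s 1%N ->
  exists2 m', reach P (pe, m) (7 * n + 200) (pe + size (epilogue pe), m')%N &
    forall i, (i <= n)%N -> m' i = out i.
Proof.
move=> /code_at_cat[] [a1 [a2 [a3 [a4 [a5 [a6 [a7 [c1 [c2 [c3 [c4 [c5 [c6 [c7 _]]]]]]]]]]]]]].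
have E7 : pe.+4.+3 = (pe + 7)%N by rewrite addnC.
rewrite E7 in c1 c2 c3 c4 c5 c6 c7.
move=> /code_at_cat[hl [e1 _]] [_ BR m2 mv ma] rn nB eo.
pose m1 := upd (upd m 5 1) 0 (B + 1)%:R.
pose m3 := upd (upd m1 6 NREG%:R) 7 (NREG * NARR)%:R.
pose m4 := upd (upd (upd m3 7 (B + NREG * NARR + 1)%:R) 8 NARR%:R) 9 (n + 1)%:R.
have r1 : reach P (pe, m) 7 (pe + 7, m4)%N.
  apply: (reach_const a1); apply: (reach_add a2).
  rewrite upd_same upd_other // m2 natr1 -[B.+1]addn1 -/m1.
  apply: (reach_const a3); apply: (reach_const a4); rewrite -/m3.
  apply: (reach_add a5).
  have -> : m3 0%N + m3 7%N = (B + NREG * NARR + 1)%:R.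
    by rewrite addnAC natrD.
  pose mm := upd (upd m3 7 (B + NREG * NARR + 1)%:R) 8 NARR%:R.
  apply: (reach_const a6); apply: (reach_add (m := mm) a7).
  have -> : mm 3%N = n%:R by rewrite -rn -(mv 0%N).
  have -> : mm 5%N = 1 by [].
  by rewrite natr1 -[n.+1]addn1; apply: reach_done; lia.
pose I k m' := [/\ outmem m', m' 5%N = 1, m' 6%N = (NREG + k)%:R,
   m' 7%N = (B + (NREG + k) * NARR + 1)%:R /\ m' 8%N = NARR%:R /\ m' 9%N = (n + 1)%:R &
   forall x, (NREG <= x < NREG + k)%N -> m' x = out x].
have I0 : I 0%N m4.
  split=> //; last by move=> x; lia.
  split=> // i; rewrite /m4 /m3 /m1 !upd_other ?ma ?eo //; move: BR; rewrite /NREG; lia.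
have [k m' kB [om k5 k6 [k7 [k8 k9]] ko]|m5 r2 [om k5 k6 [k7 [k8 k9]] ko]] :=
    @reach_iter P I (n.+1 - NREG) 7 (pe + 7) _ _ I0.
  have eok : m' (B + (NREG + k) * NARR + 1)%N = out (NREG + k)%N by case: om.
  pose m6 := upd (upd m' 10 (out (NREG + k)%N)) (NREG + k) (out (NREG + k)%N).
  have RR : NREG = 40%N by [].
  pose m7 := upd (upd m6 6 (NREG + k.+1)%:R) 7 (B + (NREG + k.+1) * NARR + 1)%:R.
  exists m7.
    apply: (reach_jlt c1); rewrite k6 k9 ltr_nat.
    have -> : (NREG + k < n + 1)%N by lia.
    have -> : (pe + 9 = (pe + 7).+2)%N by lia.
    apply: (reach_load c3 k7); rewrite eok; apply: (reach_store c4).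
      by rewrite upd_other // k6.
    rewrite upd_same -/m6; apply: (reach_add c5).
    have -> : m6 6%N + m6 5%N = (NREG + k.+1)%:R.
      by rewrite /m6 !upd_other ?k6 ?k5 ?natr1 ?addnS //; lia.
    apply: (reach_add c6).
    have -> : upd m6 6 (NREG + k.+1)%:R 7%N + upd m6 6 (NREG + k.+1)%:R 8%N =
      (B + (NREG + k.+1) * NARR + 1)%:R.
      rewrite /m6 !upd_other ?k7 ?k8 -?natrD //; try lia.
      by congr _%:R; lia.
    by apply: (reach_jmp c7); apply: reach_refl.
  split.
  - by do 4!(apply: outmem_upd; first by lia).
  - by rewrite /m7 /m6 !upd_other //; lia.
  - by rewrite /m7 upd_other // upd_same.
  - rewrite /m7 upd_same; split; first by [].
    by rewrite /m6; split; rewrite !upd_other //; lia.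
  - move=> x hx; rewrite /m7 /m6 upd_other; last lia.
    rewrite upd_other; last lia.
    case: (x =P (NREG + k)%N) => [->|ne]; first by rewrite upd_same.
    by rewrite !upd_other ?ko //; lia.
have [//||m6 r3 [[e0 om6] h1 h2]] := load_regs_ok hl _ _ om.
  by move: BR; rewrite /NREG; lia.
exists (upd m6 0 (m6 (B + 1)%N)).
  apply: reach_le (_ : reach P _ (7 + (n.+1 - NREG) * 7 + (2 + NREG.-1 * 3 + 1)) _) _; last first.
    by rewrite /NREG; lia.
  apply: reach_trans (reach_trans r1 r2) _.
  have -> : (pe + size (epilogue pe) = (pe + 14 + NREG.-1 * 3).+1)%N.
    by rewrite /=; lia.
  rewrite -addnA; apply: (reach_jlt c1); rewrite k6 k9 ltr_nat.
  have -> : (NREG + (n.+1 - NREG) < n + 1)%N = false by lia.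
  apply: (reach_jmp c2); apply: reach_trans r3 _.
  by apply: (reach_load e1 e0); apply: reach_refl.
move=> i ni; case: (i =P 0%N) => [->|i0].
  by rewrite upd_same; have := om6 0%N; rewrite mul0n addn0.
rewrite upd_other //; case: (ltnP i NREG) => le; first by apply: h2; move: le; rewrite /NREG; lia.
by rewrite h1 ?ko //; move: le; rewrite /NREG; lia.
Qed.

End Epilogue.

(** * The complete machine program and its running time *)

Definition compile (c : cmd) : seq instr :=
  let p := prologue ++ compC c (size prologue) in p ++ epilogue (size p).

Theorem compile_correct (c : cmd) : cwf 2 c -> (depth c <= 2)%N ->
  forall (n N : nat) (m0 : memory),
  (n <= N)%N -> m0 0%N = n%:R -> m0 1%N = N%:R ->
  (forall p, ((N + NREG) * (N + NREG) <= p)%N -> m0 p = 0) ->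
  exists (t : nat) (mf : memory),
    [/\ halts_in (compile c) m0 t mf,
        forall i, (i <= n)%N -> mf i = eval c (env0 n N) (arrays0 m0) 1%N i &
        ((1 <= N)%N -> (t <= (ccost 1 c + 110 * 100) * N ^ 2)%N)].
Proof.
move=> wc dc n N m0 nN e0 e1 eB; set B := ((N + NREG) * (N + NREG))%N in eB.
have nB : (n < B)%N by rewrite /B /NREG; nia.
pose p1 := prologue; pose p2 := compC c (size prologue); pose p3 := epilogue (size (p1 ++ p2)).
have hP : compile c = p1 ++ p2 ++ p3 by rewrite /compile -catA.
have h1 : code_at (compile c) 0 p1 by rewrite hP; apply: (code_at_full [::] p1 (p2 ++ p3)).
have h2 : code_at (compile c) (size p1) p2 by rewrite hP; apply: code_at_full.
have h3 : code_at (compile c) (size (p1 ++ p2)) p3.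
  by have := code_at_full (p1 ++ p2) p3 [::]; rewrite cats0 -catA -hP.
have BB : (1600 <= B)%N by rewrite /B /NREG; nia.
have BE : (NREG + N)%:R * (NREG + N)%:R = B%:R :> rat.
  by rewrite -natrM /B [(NREG + N)%N]addnC.
have [m1 r1 rm1] := prologue_ok BB BE h1 e0 e1 eB.
have [m2 r2 rm2] := comp_ok (N := N) h2 wc (leqnn 2) nN (leqnn N) rm1.
rewrite -size_cat in r2.
have [m3 r3 om] := epilogue_ok h3 rm2 (erefl n) nB (frefl _).
have [k' kT' ek'] := reach_trans (reach_trans r1 r2) r3.
exists k', m3; split; [|exact: om|].
  exists (size (compile c)); split; last by rewrite nth_default.
  by rewrite ek'; congr (Some (_, _)); rewrite hP catA [RHS]size_cat.
move=> N1; apply: leq_trans kT' _.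
have le1 : (ccost N c <= ccost 1 c * N ^ 2)%N.
  by apply: leq_trans (ccost_poly c N1) _; rewrite leq_mul2l leq_pexp2l ?orbT.
(* For [1 <= N] one has [N + 40 <= 41 * N], and 1681 is the square of 41. Six times this, plus the
   linear and constant terms of prologue and epilogue, stays below [110 * 100]. *)
have le2 : (B <= 1681 * N ^ 2)%N by rewrite /B /NREG -mulnn; nia.
have le3 : (N <= N ^ 2)%N by rewrite -mulnn; nia.
rewrite mulnDl; move: le1 le2 le3; move: (N ^ 2)%N (ccost 1 c * N ^ 2)%N => x y.
by move: (ccost N c) nN {BB BE nB r1 rm1 r2 rm2 h3 r3 om ek' eB}; clearbody B; lia.
Qed.

(** * Leaf elimination *)

(** Only the costs are compared; the code travels with the winner. *)
Definition pmin (p q : rat * rat) : rat * rat := if p.1 < q.1 then p else q.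

Lemma fstD (p q : rat * rat) : (p + q).1 = p.1 + q.1. Proof. by []. Qed.

Lemma pmin_l p q : (pmin p q).1 <= p.1.
Proof. by rewrite /pmin; case: ltP. Qed.

Lemma pmin_r p q : (pmin p q).1 <= q.1.
Proof. by rewrite /pmin; case: ltP => // /ltW. Qed.

Lemma pminP p q : pmin p q = p \/ pmin p q = q.
Proof. by rewrite /pmin; case: ifP; [left | right]. Qed.

(* A table entry is a pair: a cost, and the code of the partial solution that
   attains it.  In a configuration [(y, z)], [y k] is the value of node [k], and
   [z k] is the conjunction of its eliminated children; nothing has been
   eliminated below an [unset] node, whose [z k] is thus the empty conjunction. *)
Record tables (T : finType) := Tables {
  alive : pred T;
  unset : pred T;
  tabF : T -> bool -> rat * rat;
  tabG : T -> bool -> rat * rat;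
  tabK : rat * rat }.

Section Elimination.
Variables (T : finType) (d : rel T).
Implicit Types (s : tables T) (y z : T -> bool).

Definition children_true s y k : bool := [forall l, (alive s l && d k l) ==> y l].

(** A node that is not [unset] and has no alive child satisfies [y k = z k] and is otherwise
    unconstrained. This is how a singleton, that is a variable, takes either value. *)
Definition valid s y z : Prop := forall k, alive s k ->
  y k = z k && children_true s y k /\ (unset s k -> z k).

Definition value s y z : rat * rat :=
  tabK s + \sum_(k | alive s k) (tabF s k (z k) + tabG s k (y k)).

(** Towards the new tables the cost may drop, as entries are minima. Backwards the whole pair has to
    be matched exactly, so that the code in a table always belongs to a configuration that attains
    the cost. *)
Definition refines s s' : Prop :=
  (forall y z, valid s y z ->
     exists y' z', valid s' y' z' /\ (value s' y' z').1 <= (value s y z).1) /\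
  (forall y' z', valid s' y' z' ->
     exists y z, valid s y z /\ value s y z = value s' y' z').

Section Step.
Variables (s s' : tables T) (u : T).
Hypothesis alive_u : alive s u.
Hypothesis set_u : ~~ unset s u.
Hypothesis irr_u : ~~ d u u.
Hypothesis alive' : forall k, alive s' k = alive s k && (k != u).

Lemma value_u y z : value s y z = tabK s + (tabF s u (z u) + tabG s u (y u)) +
  \sum_(k | alive s' k) (tabF s k (z k) + tabG s k (y k)).
Proof. by rewrite /value (bigD1 u) //= addrA; under [in RHS]eq_bigl do rewrite alive'. Qed.

Lemma children_true_same y y' k :
  (forall l, alive s' l -> y l = y' l) -> (d k u -> y u) ->
  children_true s y k = children_true s' y' k.
Proof.
move=> eqy yu; apply/forallP/forallP => h l; apply/implyP.
  case/andP=> al dl; rewrite -eqy //; move: al; rewrite alive' => /andP[al _].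
  by have := h l; rewrite al dl.
case/andP=> al dl; have [e|ne] := eqVneq l u; first by rewrite e yu // -e.
have al' : alive s' l by rewrite alive' al.
by have := h l; rewrite al' dl eqy.
Qed.

(** An isolated set node has [y u = z u], free and independent of all others, so its cheaper value
    goes into the constant. *)
Lemma elim_isolated :
  (forall l, alive s' l -> ~~ d u l && ~~ d l u) ->
  (forall k, alive s' k -> unset s' k = unset s k) ->
  (forall k b, alive s' k -> tabF s' k b = tabF s k b) ->
  (forall k b, alive s' k -> tabG s' k b = tabG s k b) ->
  tabK s' = tabK s + pmin (tabF s u false + tabG s u false)
                          (tabF s u true + tabG s u true) ->
  refines s s'.
Proof.
move=> iso eU eF eG eK.
have nu k : alive s' k -> (k == u) = false by rewrite alive' => /andP[_ /negbTE].
have nd k : alive s' k -> d k u -> false by move=> /iso/andP[_ /negbTE ->].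
have sumE y z y' z' : (forall k, alive s' k -> y k = y' k /\ z k = z' k) ->
    \sum_(k | alive s' k) (tabF s' k (z' k) + tabG s' k (y' k)) =
    \sum_(k | alive s' k) (tabF s k (z k) + tabG s k (y k)).
  by move=> e; apply: eq_bigr => k ak; have [-> ->] := e k ak; rewrite eF // eG.
split=> [y z hv|y z hv].
  exists y, z; split.
    move=> k ak; have ak0 : alive s k by move: ak; rewrite alive' => /andP[].
    have [e1 e2] := hv k ak0; rewrite eU //; split=> //.
    by rewrite e1 (@children_true_same y y) // => /(nd k ak).
  rewrite value_u /value (sumE y z) // eK !fstD.
  have yz : y u = z u.
    have [-> _] := hv u alive_u; rewrite (_ : children_true s y u) ?andbT //.
    apply/forallP => l; apply/implyP => /andP[al dl].
    have [e|ne] := eqVneq l u; first by rewrite e (negbTE irr_u) in dl.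
    by move: (iso l); rewrite alive' al ne dl => /(_ isT).
  rewrite yz -!fstD lerD2r !fstD lerD2l.
  by case: (z u); [apply: pmin_r | apply: pmin_l].
have [b eb] : exists b, tabK s' = tabK s + (tabF s u b + tabG s u b).
  by rewrite eK; case: (pminP (tabF s u false + tabG s u false)
    (tabF s u true + tabG s u true)) => ->; [exists false | exists true].
pose y0 k := if k == u then b else y k; pose z0 k := if k == u then b else z k.
have e0 k : alive s' k -> y0 k = y k /\ z0 k = z k by move=> /nu; rewrite /y0 /z0 => ->.
exists y0, z0; split; last first.
  by rewrite value_u /value (sumE y0 z0) // eb /y0 /z0 eqxx.
move=> k ak; have [->|ne] := eqVneq k u.
  rewrite /y0 /z0 eqxx (negbTE set_u); split=> //.
  suff -> : children_true s y0 u by rewrite andbT.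
  apply/forallP => l; apply/implyP => /andP[al dl].
  have [e|ne] := eqVneq l u; first by rewrite e (negbTE irr_u) in dl.
  by move: (iso l); rewrite alive' al ne dl => /(_ isT).
have ak' : alive s' k by rewrite alive' ak.
have [-> ->] := e0 k ak'; have [e1 e2] := hv k ak'; rewrite -eU //; split=> //.
by rewrite e1 (@children_true_same y0 y) // => [l /e0[]//|/(nd k ak')].
Qed.

Lemma children_true_parent y y' k :
  (forall l, alive s' l -> y l = y' l) -> d k u ->
  children_true s y k = y u && children_true s' y' k.
Proof.
move=> eqy dku; have [yu|nyu] := boolP (y u); first exact: children_true_same.
by apply/negbTE/forallP => /(_ u); rewrite alive_u dku (negbTE nyu).
Qed.

Lemma children_true_leaf y v : (forall l, alive s' l -> l != v -> ~~ d u l) ->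
  children_true s y u = (alive s' v && d u v) ==> y v.
Proof.
move=> hd; apply/forallP/implyP => [h /andP[av dv]|h l].
  by have := h v; rewrite dv; move: av; rewrite alive' => /andP[-> _].
apply/implyP => /andP[al dl].
have ne : l != u by apply: contraTneq dl => ->.
have al' : alive s' l by rewrite alive' al.
have [e|nv] := eqVneq l v; first by rewrite e h // -e al' dl.
by have := hd l al' nv; rewrite dl.
Qed.

Lemma value_uv v y z : alive s' v -> value s y z =
  tabK s + (tabF s u (z u) + tabG s u (y u)) + (tabF s v (z v) + tabG s v (y v)) +
  \sum_(k | alive s' k && (k != v)) (tabF s k (z k) + tabG s k (y k)).
Proof. by move=> av; rewrite value_u (bigD1 v) //= addrA. Qed.

Lemma value_v v y z : alive s' v -> value s' y z =
  tabK s' + (tabF s' v (z v) + tabG s' v (y v)) +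
  \sum_(k | alive s' k && (k != v)) (tabF s' k (z k) + tabG s' k (y k)).
Proof. by move=> av; rewrite /value (bigD1 v) //= addrA. Qed.

(** Having no alive child, [u] has one bit [b = y u = z u], which turns the conjunction [z v] into
    [z v && b]. The minimum for the result false runs over the three pairs with a false conjunct; if
    [v] is unset, [z v] is true and only [b = false] remains. *)
Lemma elim_parent v : alive s' v -> d v u ->
  (forall l, alive s' l -> ~~ d u l) ->
  (forall l, alive s' l -> l != v -> ~~ d l u) ->
  (forall k, alive s' k -> unset s' k = unset s k && (k != v)) ->
  (forall k b, alive s' k -> k != v -> tabF s' k b = tabF s k b) ->
  (forall k b, alive s' k -> tabG s' k b = tabG s k b) ->
  tabK s' = tabK s ->
  (let h b := tabF s u b + tabG s u b in
   tabF s' v true = tabF s v true + h true /\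
   tabF s' v false = if unset s v then tabF s v true + h false
     else pmin (tabF s v false + h false)
       (pmin (tabF s v false + h true) (tabF s v true + h false))) ->
  refines s s'.
Proof.
move=> av dvu du dl eU eF eG eK /=; pose h b : rat * rat := tabF s u b + tabG s u b.
rewrite -/(h true) -/(h false) => -[eT eN].
(* The new [tabF] is a min-plus convolution along conjunction: [conv_le] says that no admissible
   pair beats it, [conv_eq] that some admissible pair attains it. *)
have conv_le (zv b : bool) : (unset s v -> zv) ->
    (tabF s' v (zv && b)).1 <= (tabF s v zv).1 + (h b).1.
  rewrite -fstD; case: zv; case: b => /= hz; rewrite ?eT //= eN.
  - by case: ifP => // _; apply: le_trans (pmin_r _ _) (pmin_r _ _).
  - case: ifP hz => [_ /(_ isT)//|_ _].
    exact: le_trans (pmin_r _ _) (pmin_l _ _).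
  - by case: ifP hz => [_ /(_ isT)//|_ _]; apply: pmin_l.
have conv_eq w : exists zv b,
    [/\ zv && b = w, unset s v -> zv & tabF s' v w = tabF s v zv + h b].
  case: w; first by exists true, true; split.
  rewrite eN; case: ifP => _; first by exists true, false; split.
  set q := pmin (tabF s v false + h true) _.
  case: (pminP (tabF s v false + h false) q) => ->; first by exists false, false; split.
  case: (pminP (tabF s v false + h true) (tabF s v true + h false)); rewrite /q => ->.
    by exists false, true; split.
  by exists true, false; split.
have nu k : alive s' k -> (k == u) = false by rewrite alive' => /andP[_ /negbTE].
have as0 k : alive s' k -> alive s k by rewrite alive' => /andP[].
have vu := nu v av.
have leaf y : children_true s y u.
  by rewrite (@children_true_leaf _ v) ?(negbTE (du v av)) ?andbF // => l /du.
have sumE y z y' z' : (forall k, alive s' k -> k != v -> y k = y' k /\ z k = z' k) ->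
    \sum_(k | alive s' k && (k != v)) (tabF s' k (z' k) + tabG s' k (y' k)) =
    \sum_(k | alive s' k && (k != v)) (tabF s k (z k) + tabG s k (y k)).
  by move=> e; apply: eq_bigr => k /andP[ak kv]; have [-> ->] := e k ak kv; rewrite eF // eG.
split=> [y z hv|y z hv].
  pose z' k := if k == v then z v && y u else z k.
  exists y, z'; split.
    move=> k ak; have [e1 e2] := hv k (as0 k ak); rewrite eU // /z'.
    have [e|kv] := eqVneq k v.
      split; last by rewrite andbF.
      by rewrite e1 e (@children_true_parent y y) // andbA.
    rewrite andbT; split=> //.
    by rewrite e1 (@children_true_same y y) // (negbTE (dl k ak kv)).
  rewrite (value_uv _ _ av) (value_v _ _ av) (sumE y z); last first.
    by move=> k ak kv; rewrite /z' (negbTE kv).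
  have [eu _] := hv u alive_u; have [_ ev] := hv v (as0 v av).
  rewrite leaf andbT in eu.
  rewrite eK eG // /z' eqxx -eu !fstD.
  by have := conv_le (z v) (y u) ev; rewrite /h fstD; lra.
have [zv [b [ezb hzv eF']]] := conv_eq (z v).
pose y0 k := if k == u then b else y k.
pose z0 k := if k == u then b else if k == v then zv else z k.
have y0E k : alive s' k -> y0 k = y k by move=> /nu; rewrite /y0 => ->.
exists y0, z0; split; last first.
  rewrite (value_uv _ _ av) (value_v _ _ av) (sumE y0 z0); last first.
    by move=> k ak kv; rewrite y0E // /z0 nu // (negbTE kv).
  rewrite eK eG // eF' (y0E v av) /z0 /y0 !eqxx vu /= -/(h b); congr (_ + _).
  by move: (h b) => hb; rewrite -!addrA; congr (_ + _); rewrite addrCA.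
move=> k ak; have [->|ne] := eqVneq k u.
  by rewrite leaf andbT /y0 /z0 eqxx (negbTE set_u).
have ak' : alive s' k by rewrite alive' ak.
rewrite y0E //; have [e1 e2] := hv k ak'; rewrite eU // in e2.
have [e|kv] := eqVneq k v.
  rewrite e in e1 *; rewrite (@children_true_parent y0 y) // /z0 vu eqxx /y0 eqxx.
  by rewrite andbA ezb.
rewrite kv andbT in e2; rewrite /z0 (negbTE ne) (negbTE kv); split=> //.
by rewrite e1 (@children_true_same y0 y) // (negbTE (dl k ak' kv)).
Qed.

(** Here [y u = z u && y v]. Minimizing over the free bit [z u] leaves a function of [y v] alone,
    which is why it is added to [tabG] of [v]. *)
Lemma elim_child v : alive s' v -> d u v ->
  (forall l, alive s' l -> ~~ d l u) ->
  (forall l, alive s' l -> l != v -> ~~ d u l) ->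
  (forall k, alive s' k -> unset s' k = unset s k) ->
  (forall k b, alive s' k -> tabF s' k b = tabF s k b) ->
  (forall k b, alive s' k -> k != v -> tabG s' k b = tabG s k b) ->
  tabK s' = tabK s ->
  (forall b, tabG s' v b = tabG s v b +
     pmin (tabF s u false + tabG s u false) (tabF s u true + tabG s u b)) ->
  refines s s'.
Proof.
move=> av duv dl du eU eF eG eK eGv.
have nu k : alive s' k -> (k == u) = false by rewrite alive' => /andP[_ /negbTE].
have as0 k : alive s' k -> alive s k by rewrite alive' => /andP[].
have leaf y : children_true s y u = y v.
  by rewrite (@children_true_leaf _ v) // av duv.
have nd k : alive s' k -> d k u -> false by move=> /dl/negbTE ->.
have sumE y z y' z' : (forall k, alive s' k -> y k = y' k /\ z k = z' k) ->
    \sum_(k | alive s' k && (k != v)) (tabF s' k (z' k) + tabG s' k (y' k)) =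
    \sum_(k | alive s' k && (k != v)) (tabF s k (z k) + tabG s k (y k)).
  by move=> e; apply: eq_bigr => k /andP[ak kv]; have [-> ->] := e k ak; rewrite eF // eG.
pose g zu b : rat * rat := tabF s u zu + tabG s u (zu && b).
have eGv' b : tabG s' v b = tabG s v b + pmin (g false b) (g true b) by rewrite eGv.
split=> [y z hv|y z hv].
  exists y, z; split.
    move=> k ak; have [e1 e2] := hv k (as0 k ak); rewrite eU //; split=> //.
    by rewrite e1 (@children_true_same y y) // => /(nd k ak).
  rewrite (value_uv _ _ av) (value_v _ _ av) (sumE y z) // eK eF // eGv'.
  have [-> _] := hv u alive_u; rewrite leaf !fstD.
  have := pmin_l (g false (y v)) (g true (y v)).
  have := pmin_r (g false (y v)) (g true (y v)).
  by rewrite /g; case: (z u); rewrite !fstD /=; lra.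
have [zu ez] : exists zu, tabG s' v (y v) = tabG s v (y v) + g zu (y v).
  by rewrite eGv'; case: (pminP (g false (y v)) (g true (y v))) => ->;
    [exists false | exists true].
pose y0 k := if k == u then zu && y v else y k.
pose z0 k := if k == u then zu else z k.
have e0 k : alive s' k -> y0 k = y k /\ z0 k = z k by move=> /nu; rewrite /y0 /z0 => ->.
exists y0, z0; split; last first.
  rewrite (value_uv _ _ av) (value_v _ _ av) (sumE y0 z0) //.
  have [-> ->] := e0 v av.
  rewrite eK eF // ez /z0 /y0 !eqxx /= -/(g zu (y v)); congr (_ + _).
  by move: (g _ _) => gz; rewrite -!addrA; congr (_ + _); rewrite addrC addrA.
move=> k ak; have [->|ne] := eqVneq k u.
  by rewrite leaf (e0 v av).1 /y0 /z0 eqxx (negbTE set_u).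
have ak' : alive s' k by rewrite alive' ak.
have [-> ->] := e0 k ak'; have [e1 e2] := hv k ak'; rewrite -eU //; split=> //.
by rewrite e1 (@children_true_same y0 y) // => [l /e0[]//|/(nd k ak')].
Qed.

End Step.
End Elimination.

(** * Binary codes of sets of variables *)

(** Decoding must treat the heaviest digit first; with decreasing weights this agrees with loops
    that count upwards. *)
Definition weight (i : nat) : rat := 2^-1 ^+ i.

Lemma weight_gt0 i : 0 < weight i.
Proof. by rewrite exprn_gt0 // invr_gt0. Qed.

Lemma weightS i : 2 * weight i.+1 = weight i.
Proof. by rewrite /weight exprS mulrA divff ?mul1r. Qed.

Definition tail (n : nat) (x : nat -> bool) (i : nat) : rat :=
  \sum_(i <= j < n) (x j : nat)%:R * weight j.

Lemma tail_rec n x i : (i < n)%N ->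
  tail n x i = (x i : nat)%:R * weight i + tail n x i.+1.
Proof. by move=> lt; rewrite /tail big_ltn. Qed.

Lemma tail_ge0 n x i : 0 <= tail n x i.
Proof. by apply: sumr_ge0 => j _; rewrite mulr_ge0 ?ler0n ?ltW ?weight_gt0. Qed.

Lemma tail_lt n x i : (i <= n)%N -> tail n x i < 2 * weight i.
Proof.
(* Induction on [n - i], from the last digit backwards: the sum is dominated by a geometric
   series. *)
move=> le; rewrite -(subKn le); elim: (n - i)%N => [|k IH].
  by rewrite subn0 /tail big_geq // mulr_gt0 ?weight_gt0.
have [lt|ge] := ltnP k n; last by rewrite (_ : (n - k.+1 = n - k)%N) //; lia.
have e : (n - k = (n - k.+1).+1)%N by lia.
rewrite tail_rec; last lia.
move: IH; rewrite e weightS; have := weight_gt0 (n - k.+1).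
by case: (x _); rewrite /= ?mul1r ?mul0r; lra.
Qed.

(** The digits after [i] weigh less than [weight i] together, so one comparison reads digit [i]. The
    machine needs no division or rounding for decoding. *)
Lemma tail_digit n x i : (i < n)%N -> (tail n x i < weight i) = ~~ x i.
Proof.
move=> lt; rewrite tail_rec //.
have := tail_lt x lt; rewrite weightS; have := tail_ge0 n x i.+1.
by case: (x i) => /= h1 h2; rewrite ?mul1r ?mul0r; apply/idP/idP; lra.
Qed.

Lemma tail_inj n x y : tail n x 0 = tail n y 0 -> forall j, (j < n)%N -> x j = y j.
Proof.
move=> e0; suff h j : (j <= n)%N -> tail n x j = tail n y j.
  by move=> j lt; apply: negb_inj; rewrite -!(tail_digit _ lt) h // ltnW.
elim: j => // j IH lt; have e := IH (ltnW lt).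
have xy : x j = y j by apply: negb_inj; rewrite -!(tail_digit _ lt) e.
by move: e; rewrite (tail_rec x lt) (tail_rec y lt) xy => /addrI.
Qed.

Section Codes.
Variable n : nat.

Definition bit (m : {set 'I_n}) (j : nat) : bool :=
  [exists i : 'I_n, (i \in m) && (val i == j)].

Lemma bitE m (i : 'I_n) : bit m i = (i \in m).
Proof.
apply/existsP/idP => [[j /andP[jm /eqP/val_inj <-]]//|im].
by exists i; rewrite im eqxx.
Qed.

Definition code (m : {set 'I_n}) : rat := \sum_(i in m) weight i.

Lemma codeE m : code m = tail n (bit m) 0.
Proof.
rewrite /tail big_mkord /code big_mkcond; apply: eq_bigr => i _.
by rewrite bitE; case: (i \in m); rewrite /= ?mul1r ?mul0r.
Qed.

Lemma code_inj : injective code.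
Proof.
move=> m1 m2; rewrite !codeE => /tail_inj e.
by apply/setP => i; rewrite -!bitE e.
Qed.

End Codes.

(** * Trees of monomials *)

(** A simple path from [v1] to [v2] that avoids [u] closes up through [u]; it has at least two nodes
    because [v1] and [v2] differ. *)
Lemma cycle_of_connected (T : finType) (e : rel T) (u v1 v2 : T) :
  e u v1 -> e v2 u -> v1 != v2 -> v1 != u -> v2 != u ->
  connect [rel x y | [&& e x y, x != u & y != u]] v1 v2 ->
  exists s, [/\ uniq s, (3 <= size s)%N & cycle e s].
Proof.
move=> eu1 e2u ne n1 n2 /connectP[p hp e2]; move: ne n2 e2u; rewrite {}e2.
case/shortenP: hp => p' hp' up' _ ne n2 e2u.
exists [:: u, v1 & p']; split.
- rewrite cons_uniq up' andbT inE negb_or eq_sym n1 /=.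
  elim: p' v1 {eu1 n1 up' ne e2u n2} hp' => [|x q IH] v //= /andP[/and3P[_ _ xu] hq].
  by rewrite inE negb_or eq_sym xu (IH x).
- by case: p' ne {hp' up' n2 e2u} => //=; rewrite eqxx.
- rewrite /= eu1 rcons_path e2u andbT.
  by apply: sub_path hp' => x y /and3P[].
Qed.

(* Otherwise every simple path could be prolonged inside [A]. *)
Lemma acyclic_leaf (T : finType) (e : rel T) (A : pred T) (x0 : T) :
  symmetric e -> irreflexive e ->
  (forall s, uniq s -> (3 <= size s)%N -> ~~ cycle e s) ->
  A x0 -> exists2 u, A u & (#|[pred v | A v && e u v]| <= 1)%N.
Proof.
move=> es ei ac A0.
case: (pickP [pred u | A u && (#|[pred v | A v && e u v]| <= 1)%N]) => [u /andP[]|no].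
  by exists u.
have deg u w : A u -> exists v, [/\ A v, e u v & v != w].
  move=> Au; have := no u; rewrite /= Au /= => /negbT; rewrite -ltnNge => h.
  case: (pickP [pred v | (A v && e u v) && (v != w)]) => [v /andP[/andP[? ?] ?]|n0].
    by exists v.
  move: h; rewrite ltnNge; case/negP; rewrite -(card1 w); apply: subset_leq_card.
  apply/subsetP => v; rewrite !inE => hv; have := n0 v; rewrite /= hv /=.
  by move/negbFE.
have ext k : exists u v p, [/\ uniq [:: u, v & p], A u, path e u (v :: p) & size p = k].
  elim: k => [|k [u [v [p [us Au hp sp]]]]].
    have [v [Av ev _]] := deg x0 x0 A0.
    exists x0, v, [::]; rewrite /= ev inE; split=> //.
    by rewrite andbT; apply: contraTneq ev => ->; rewrite ei.
  have [w [Aw euw wv]] := deg u v Au.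
  have wu : w != u by apply: contraTneq euw => ->; rewrite ei.
  (* The path grows at its head [u]. A new neighbour [w] that lies on it already would close the
     part of the path up to [w] into a cycle. *)
  have [win|wout] := boolP (w \in p); last first.
    exists w, u, (v :: p); split=> //; last by rewrite /= sp.
      by rewrite cons_uniq us !inE !negb_or wu wv wout.
    by move: hp => /= ->; rewrite es euw.
  case/splitPr: win us hp {sp} => p1 p2 us hp.
  have := ac (u :: v :: rcons p1 w); rewrite -cat_rcons in us hp.
  rewrite -!cat_cons cat_uniq in us; case/andP: us => us _.
  rewrite us /= size_rcons => /(_ isT isT).
  move: hp; rewrite /= cat_path => /andP[-> /andP[hp _]] /=.
  by rewrite rcons_path hp last_rcons es euw.
have [u [v [p [us _ _ sp]]]] := ext #|T|.
by have := max_card (mem [:: u, v & p]); rewrite (card_uniqP us) /= sp ltnNge leqnSn.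
Qed.

(** * Simple linearizations with acyclic graph *)

Section Linearized.
Variables (n : nat) (M : {set {set 'I_n}}) (C : {set {set {set 'I_n}}}).
Hypothesis lin : is_linearization M C.
Hypothesis cons : consistent M C.
Hypothesis simp : simple_lin M C.
Hypothesis acyc : acyclic_G M C.

Definition nonsingle (m : {set 'I_n}) : bool := (1 < #|m|)%N.

(** By counting: each non-singleton of [M] is the resultant of one constraint, so the constraints
    with non-singleton resultant already number [|C|]. *)
Lemma resultant_nonsingle c : c \in C -> nonsingle (resultant c).
Proof.
pose NS := [set m in M | nonsingle m].
pose C' := [set c in C | resultant c \in NS].
suff -> : C = C' by rewrite !inE => /and3P[].
apply/esym/eqP; rewrite eqEcard; apply/andP; split.
  by apply/subsetP => d; rewrite inE => /andP[].
rewrite simp.2 -sum1_card [X in (_ <= X)%N](_ : _ = \sum_(m in NS) 1)%N //.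
rewrite -[#|C'|]sum1_card (partition_big (@resultant n) (mem NS)) /=; last first.
  by move=> d; rewrite inE => /andP[].
apply: eq_bigr => m mN; rewrite sum1_card.
have /andP[mM m1] : (m \in M) && nonsingle m by move: mN; rewrite inE.
rewrite -(simp.1 m mM m1); apply: eq_card => d.
rewrite unfold_in !inE.
by case: (resultant d =P m) => [->|_]; rewrite ?andbF // mM m1 !andbT.
Qed.

Lemma singles_imset : M :\: [set m | nonsingle m] = [set [set i] | i : 'I_n].
Proof.
have [l1 [l2 l3]] := lin.
apply/setP => m; rewrite !inE -leqNgt; apply/andP/imsetP => [[m1 mM]|[i _ ->]].
  have : (0 < #|m|)%N by rewrite card_gt0 l1.
  move=> m0; have /cards1P[i ->] : #|m| == 1%N by rewrite eqn_leq m1.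
  by exists i.
by rewrite cards1 l2.
Qed.

(** Besides bounding the input size, this gives the program the test [j + n < N] for [j < |C|]. *)
Lemma card_MC : (#|C| + n = #|M|)%N.
Proof.
rewrite simp.2 -(cardsID [set m | nonsingle m] M); congr (_ + _)%N.
  by apply: eq_card => m; rewrite !inE.
rewrite singles_imset.
by rewrite card_imset ?card_ord //; apply: set1_inj.
Qed.

Lemma arcP m l : reflect (exists2 c, c \in C & resultant c = m /\ l \in c) (arc M C m l).
Proof.
apply: (iffP existsP) => [[c /andP[cC /andP[/eqP cm lc]]]|[c cC [cm lc]]]; exists c => //.
by rewrite cC cm eqxx.
Qed.

Lemma same_constraint c1 c2 : c1 \in C -> c2 \in C ->
  resultant c1 = resultant c2 -> c1 = c2.
Proof.
move=> h1 h2 e; have [_ [_ l3]] := lin.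
have /eqP/cards1P[c ec] := simp.1 _ (l3 c1 h1).2 (resultant_nonsingle h1).
have : c1 \in [set c in C | resultant c == resultant c1] by rewrite inE h1 eqxx.
have : c2 \in [set c in C | resultant c == resultant c1] by rewrite inE h2 e eqxx.
by rewrite ec !inE => /eqP -> /eqP ->.
Qed.

Lemma arc_facts m l : arc M C m l ->
  [/\ m \in M, l \in M, nonsingle m, l \subset m & (#|l| < #|m|)%N].
Proof.
case/arcP=> c cC [<- lc]; have [_ [_ l3]] := lin.
have [cM rM] := l3 c cC; have ns := resultant_nonsingle cC.
split=> //; first exact: (subsetP cM).
  exact: bigcup_sup.
(* Consistency only provides some constraint with strictly smaller members; uniqueness identifies it
   with [c]. *)
have [c' c'C [e lt]] := cons rM ns.
by apply: lt; rewrite (same_constraint c'C cC e).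
Qed.

Lemma arc_cover m i : m \in M -> nonsingle m -> i \in m ->
  exists2 l, arc M C m l & i \in l.
Proof.
move=> mM ns im; have [c cC [e _]] := cons mM ns.
move: im; rewrite -e => /bigcupP[l lc il]; exists l => //.
by apply/arcP; exists c.
Qed.

(** A child containing [i] is a proper subset and misses some [j]; a child containing [j] is then a
    different one. *)
Lemma arc_two m : m \in M -> nonsingle m ->
  exists l1 l2, [/\ arc M C m l1, arc M C m l2 & l1 != l2].
Proof.
move=> mM ns; have : (0 < #|m|)%N by apply: ltnW.
rewrite card_gt0 => /set0Pn[i im].
have [l1 a1 il1] := arc_cover mM ns im.
have [_ _ _ s1 lt1] := arc_facts a1.
have /subsetPn[j jm jl] : ~~ (m \subset l1).
  by apply: contraL lt1 => /subset_leq_card; rewrite leqNgt.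
have [l2 a2 jl2] := arc_cover mM ns jm.
by exists l1, l2; split=> //; apply: contraNneq jl => ->.
Qed.

Lemma undir_sym : symmetric (undir_adj M C).
Proof.
move=> u v; rewrite /undir_adj eq_sym orbC.
by case: (u \in M); case: (v \in M).
Qed.

Lemma undir_irr : irreflexive (undir_adj M C).
Proof. by move=> u; rewrite /undir_adj eqxx !andbF. Qed.

Lemma arc_adj m l : arc M C m l -> undir_adj M C m l.
Proof.
move=> a; have [mM lM _ _ lt] := arc_facts a.
rewrite /undir_adj mM lM a /= andbT.
by apply: contraTneq lt => ->; rewrite ltnn.
Qed.

Lemma adjE m l : undir_adj M C m l = arc M C m l || arc M C l m.
Proof.
apply/idP/orP => [/and4P[_ _ _ /orP]//|[/arc_adj//|/arc_adj]].
by rewrite undir_sym.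
Qed.

Lemma arc_asym m l : arc M C m l -> ~~ arc M C l m.
Proof.
move=> /arc_facts[_ _ _ _ lt]; apply/negP => /arc_facts[_ _ _ _].
by rewrite ltnNge ltnW.
Qed.

(** Pass repeatedly to a child that contains [i]. Cardinalities decrease, so the descent ends in the
    singleton and never meets the larger set [u]. *)
Lemma descend (u m : {set 'I_n}) i : m \in M -> (#|m| < #|u|)%N -> i \in m ->
  connect [rel x y | [&& undir_adj M C x y, x != u & y != u]] m [set i].
Proof.
have [k] := ubnP #|m|; elim: k m => // k IH m lemk mM lt im.
have [ns|] := boolP (nonsingle m); last first.
  rewrite /nonsingle -leqNgt => m1.
  have /cards1P[j e] : #|m| == 1%N.
    by rewrite eqn_leq m1 card_gt0; apply/set0Pn; exists i.
  by move: im; rewrite e inE => /eqP ->; apply: connect0.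
have [l a il] := arc_cover mM ns im.
have [_ lM _ _ ltl] := arc_facts a.
have ltu := ltn_trans ltl lt.
apply: connect_trans (IH l _ lM ltu il); last by apply: leq_trans ltl _.
apply: connect1; rewrite /= arc_adj //=.
by apply/andP; split; [apply: contraTneq lt | apply: contraTneq ltu] => ->; rewrite ltnn.
Qed.

(* Two overlapping children would be joined by a second path through a common variable. *)
Lemma children_disjoint c : c \in C -> trivIset c.
Proof.
move=> cC; apply/trivIsetP => l1 l2 h1 h2 ne.
set u := resultant c.
have a1 : arc M C u l1 by apply/arcP; exists c.
have a2 : arc M C u l2 by apply/arcP; exists c.
have [_ m1 _ _ lt1] := arc_facts a1; have [_ m2 _ _ lt2] := arc_facts a2.
apply/negPn/negP => /pred0Pn[i /andP[/= i1 i2]].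
have sym : connect_sym [rel x y | [&& undir_adj M C x y, x != u & y != u]].
  by apply: sym_connect_sym => x y /=; rewrite undir_sym [(x != u) && _]andbC.
have con := connect_trans (descend m1 lt1 i1) (_ : connect _ [set i] l2).
have {}con : connect [rel x y | [&& undir_adj M C x y, x != u & y != u]] l1 l2.
  by apply: con; rewrite sym; apply: descend.
have ne' (l : {set 'I_n}) : (#|l| < #|u|)%N -> l != u by apply: contraTneq => ->; rewrite ltnn.
have [s [us ss cs]] := cycle_of_connected (arc_adj a1)
  (etrans (undir_sym _ _) (arc_adj a2)) ne (ne' _ lt1) (ne' _ lt2) con.
by have := acyc us ss; rewrite cs.
Qed.

Lemma code_resultant c : c \in C -> code (resultant c) = \sum_(m in c) code m.
Proof. by move=> cC; rewrite /code -big_trivIset //; apply: children_disjoint. Qed.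

Lemma prod_indicator (x : {ffun 'I_n -> bool}) (m : {set 'I_n}) :
  \prod_(i in m) ((x i : nat)%:R : rat) = ([forall i in m, x i] : nat)%:R.
Proof.
have [/forall_inP h|/forall_inPn[i im nx]] := boolP [forall i in m, x i].
  by rewrite big1 // => i /h ->.
by rewrite (bigD1 i) //= (negbTE nx) mul0r.
Qed.

Lemma forall_children (x : {ffun 'I_n -> bool}) m : m \in M -> nonsingle m ->
  [forall i in m, x i] = [forall l, arc M C m l ==> [forall i in l, x i]].
Proof.
move=> mM ns; apply/forall_inP/forallP => [h l|h i im].
  apply/implyP => /arc_facts[_ _ _ /subsetP s _]; apply/forall_inP => i il.
  by apply: h; apply: s.
have [l a il] := arc_cover mM ns im.
by have := h l; rewrite a /= => /forall_inP; apply.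
Qed.

Definition mono (k : nat) : {set 'I_n} := nth set0 (enum M) k.

Lemma size_enumM : size (enum M) = #|M|. Proof. by rewrite cardE. Qed.

Lemma mono_in k : (k < #|M|)%N -> mono k \in M.
Proof. by move=> lt; rewrite -mem_enum mem_nth // size_enumM. Qed.

Lemma monomial_inj k l : (k < #|M|)%N -> (l < #|M|)%N -> mono k = mono l -> k = l.
Proof.
by move=> hk hl /eqP; rewrite /mono nth_uniq ?size_enumM ?enum_uniq // => /eqP.
Qed.

Lemma mono_surj m : m \in M -> exists k : 'I_#|M|, mono k = m.
Proof.
rewrite -mem_enum => mM; have lt : (index m (enum M) < #|M|)%N.
  by rewrite -size_enumM index_mem.
by exists (Ordinal lt); rewrite /mono /= nth_index.
Qed.

Lemma sum_mono (V : nmodType) (f : {set 'I_n} -> V) :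
  \sum_(k < #|M|) f (mono k) = \sum_(m in M) f m.
Proof.
by rewrite -[RHS]big_enum (big_nth set0) size_enumM big_mkord.
Qed.

Definition dep : rel 'I_#|M| := fun k l => arc M C (mono k) (mono l).

Lemma dep_leaf (A : pred 'I_#|M|) k0 : A k0 ->
  exists2 u, A u & (#|[pred v | A v && (dep u v || dep v u)]| <= 1)%N.
Proof.
move=> A0; pose e : rel 'I_#|M| := fun k l => undir_adj M C (mono k) (mono l).
have [|||u Au le] := @acyclic_leaf _ e A k0 _ _ _ A0.
- by move=> k l; apply: undir_sym.
- by move=> k; apply: undir_irr.
- move=> s us ss; have := @acyc [seq mono (val k) | k <- s].
  rewrite size_map cycle_map => -> //; rewrite map_inj_uniq // => k l.
  by move/monomial_inj => /(_ (ltn_ord _) (ltn_ord _)) /val_inj.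
- exists u => //; apply: leq_trans le; apply: subset_leq_card; apply/subsetP => v.
  by rewrite !inE /e adjE.
Qed.

(** * Tables that represent the minimization problem *)

Section Optimum.
Variable a : {set 'I_n} -> rat.
Local Notation obj := (objective M a).

(** The first half keeps the minimum of the tables from exceeding the optimum; the second makes
    every configuration the exact record of a solution, cost and code. *)
Definition represents (s : tables 'I_#|M|) : Prop :=
  (forall x, exists y z, valid dep s y z /\ (value s y z).1 <= obj x) /\
  (forall y z, valid dep s y z ->
     exists x : {ffun 'I_n -> bool}, value s y z = (obj x, code [set i | x i])).

Lemma represents_refines s s' : represents s -> refines dep s s' -> represents s'.
Proof.
move=> [h1 h2] [r1 r2]; split=> [x|y' z' hv].
  have [y [z [hv le]]] := h1 x; have [y' [z' [hv' le']]] := r1 y z hv.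
  by exists y', z'; split=> //; apply: le_trans le.
by have [y [z [hv0 <-]]] := r2 y' z' hv; apply: h2.
Qed.

Lemma represents_end s : represents s -> (forall k, ~~ alive s k) ->
  exists x : {ffun 'I_n -> bool}, tabK s = (obj x, code [set i | x i]) /\
    forall y, obj x <= obj y.
Proof.
move=> [h1 h2] na.
have vE y z : value s y z = tabK s.
  by rewrite /value big_pred0 ?addr0 // => k; apply/negbTE.
have vv y z : valid dep s y z by move=> k; rewrite (negbTE (na k)).
have [x ex] := h2 _ _ (vv xpredT xpredT); exists x; rewrite -ex vE; split=> // y.
have [y' [z' [_]]] := h1 y; rewrite vE -(vE xpredT xpredT) ex; exact.
Qed.

Lemma fst_sum (I : finType) (P : pred I) (f : I -> rat * rat) :
  (\sum_(i | P i) f i).1 = \sum_(i | P i) (f i).1.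
Proof. exact: (big_morph fst (fun _ _ => erefl) erefl). Qed.

Lemma snd_sum (I : finType) (P : pred I) (f : I -> rat * rat) :
  (\sum_(i | P i) f i).2 = \sum_(i | P i) (f i).2.
Proof. exact: (big_morph snd (fun _ _ => erefl) erefl). Qed.

(** Codes are charged to singletons only, so that the second components add up to the code of the
    set of true variables. *)
Lemma represents_init (s : tables 'I_#|M|) :
  (forall k, alive s k) -> (forall k, unset s k = nonsingle (mono k)) ->
  (forall k b, tabF s k b = 0) -> (forall k, tabG s k false = 0) ->
  (forall k, tabG s k true =
     (a (mono k), if nonsingle (mono k) then 0 else code (mono k))) ->
  tabK s = 0 -> represents s.
Proof.
move=> al un F0 G0 G1 K0; have [l1 [l2 l3]] := lin.
pose A (x : {ffun 'I_n -> bool}) (m : {set 'I_n}) := [forall i in m, x i].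
have chE x (y : 'I_#|M| -> bool) (k : 'I_#|M|) : nonsingle (mono k) ->
    (forall l, dep k l -> y l = A x (mono l)) -> children_true dep s y k = A x (mono k).
  move=> ns hy; rewrite /A forall_children ?mono_in //.
  apply/forallP/forallP => [h l|h l].
    apply/implyP => ar; have [_ lM _ _ _] := arc_facts ar.
    have [l' e] := mono_surj lM; have := h l'.
    have dl : dep k l' by rewrite /dep e.
    by rewrite al dl /= hy // e.
  by apply/implyP => /andP[_ dl]; rewrite hy //; have /implyP := h (mono l); apply.
have leaf y (k : 'I_#|M|) : ~~ nonsingle (mono k) -> children_true dep s y k.
  move=> ns; apply/forallP => l; apply/implyP => /andP[_ /arc_facts[_ _ ns' _ _]].
  by rewrite ns' in ns.
have valE x y z : (forall k : 'I_#|M|, y k = A x (mono k)) ->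
    value s y z = (obj x, code [set i | x i]).
  move=> ey; rewrite /value K0 add0r (eq_bigl xpredT); last exact: al.
  rewrite [LHS]surjective_pairing fst_sum snd_sum; congr (_, _).
    rewrite /objective -sum_mono; apply: eq_bigr => k _.
    rewrite F0 add0r prod_indicator ey /A.
    by case: [forall i in _, _]; rewrite ?G1 ?G0 ?mulr1 ?mulr0.
  pose g m := if nonsingle m then 0 else (A x m : nat)%:R * code m.
  rewrite (eq_bigr (fun k : 'I_#|M| => g (mono k))); last first.
    move=> k _; rewrite F0 add0r ey /g; case: (A x _); rewrite ?G1 ?G0 /= ?mul1r //.
    by rewrite mul0r if_same.
  rewrite (sum_mono g) (big_setID [set m | nonsingle m]) /= big1 ?add0r; last first.
    by move=> m; rewrite !inE /g => /andP[_ ->].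
  rewrite singles_imset big_imset /=; last by move=> i j _ _; apply: set1_inj.
  rewrite /code big_mkcond [RHS]big_mkcond; apply: eq_bigr => i _; rewrite !inE /g.
  rewrite /nonsingle cards1 /= /code big_set1 /A.
  have -> : [forall j in [set i], x j] = x i.
    apply/forall_inP/idP => [|xi j /set1P-> //]; by apply; rewrite inE.
  by case: (x i); rewrite ?mul1r ?mul0r.
split=> [x|y z hv].
  (* A resultant has lost no child yet, so its [z] is the empty conjunction; at a singleton [z] is
     the value of the variable. *)
  exists (fun k : 'I_#|M| => A x (mono k)), (fun k : 'I_#|M| => nonsingle (mono k) || A x (mono k)).
  split; last by rewrite (valE x).
  move=> k _; rewrite un; split=> [|-> //].
  have [ns|ns] := boolP (nonsingle (mono k)); first by rewrite (chE x).
  by rewrite (leaf _ _ ns) andbT.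
have ex i : exists k : 'I_#|M|, mono k == [set i].
  by have [k e] := mono_surj (l2 i); exists k; rewrite e.
pose ix i := xchoose (ex i).
have ixE i : mono (ix i) = [set i] by apply/eqP/(xchooseP (ex i)).
(* The assignment is read off the singletons. The other values of [y] are then forced, by induction
   on the size of the monomial. *)
pose x := [ffun i => y (ix i)].
exists x; apply: valE => k; have [m] := ubnP #|mono k|.
elim: m k => // m IH k lt.
have [ns|ns] := boolP (nonsingle (mono k)).
  have [-> uz] := hv k (al k); rewrite un in uz; rewrite uz //= (chE x) // => l dl.
  by apply: IH; have [_ _ _ _ ltl] := arc_facts dl; apply: leq_trans ltl _.
have /cards1P[i e] : #|mono k| == 1%N.
  by rewrite eqn_leq card_gt0 l1 ?mono_in // andbT leqNgt.
have -> : k = ix i.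
  by apply: ord_inj; apply: monomial_inj; [apply: ltn_ord.. | rewrite ixE e].
rewrite ixE /A; apply/idP/forall_inP => [yi j /set1P->|]; first by rewrite ffunE.
by move/(_ i); rewrite inE ffunE; apply.
Qed.

End Optimum.
End Linearized.

(** * The program *)

Definition pexp := (rexp * rexp)%type.
Definition padd (p q : pexp) : pexp := (RAdd p.1 q.1, RAdd p.2 q.2).
(** Selection by arithmetic, for a condition [c] that is 0 or 1; it makes a minimum of table entries
    an expression. *)
Definition rif (c a b : rexp) : rexp := RAdd (RMul c a) (RMul (RSub (RConst 1) c) b).
Definition pif (c : rexp) (p q : pexp) : pexp := (rif c p.1 q.1, rif c p.2 q.2).
Definition pminE (p q : pexp) : pexp := pif (RLt p.1 q.1) p q.
Definition peval r s (p : pexp) : rat * rat := (reval r s p.1, reval r s p.2).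
(** The code is written first: its expression compares costs and thus reads cost arrays, whereas the
    cost expression reads no codes and is not disturbed. *)
Definition set_pair (f fc : nat) (e : nexp) (p : pexp) : cmd :=
  Seq (Set_ fc e p.2) (Set_ f e p.1).

Lemma peval_add r s p q : peval r s (padd p q) = peval r s p + peval r s q.
Proof. by []. Qed.

Lemma peval_if r s a b p q :
  peval r s (pif (RLt a b) p q) =
  if reval r s a < reval r s b then peval r s p else peval r s q.
Proof.
rewrite /peval /=; case: ifP => _ /=; rewrite ?subrr ?subr0 !mul1r ?mul0r ?add0r ?addr0 //;
  by rewrite !mul0r ?add0r ?addr0.
Qed.

Lemma peval_min r s p q : peval r s (pminE p q) = pmin (peval r s p) (peval r s q).
Proof. exact: peval_if. Qed.

Fixpoint reads (f : nat) (e : rexp) : bool :=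
  match e with
  | RConst _ | RNat _ => false
  | RArr g _ => g == f
  | RAdd a b | RSub a b | RMul a b | RLt a b => reads f a || reads f b
  end.

Lemma reval_setA r s f i q e : ~~ reads f e -> reval r (setA s f i q) e = reval r s e.
Proof.
elim: e => [c|e|g e|a IHa b IHb|a IHa b IHb|a IHa b IHb|a IHa b IHb] //=.
  by rewrite /setA => /negbTE ->.
all: by rewrite negb_or => /andP[/IHa -> /IHb ->].
Qed.

Lemma peval_setA r s f i q p : ~~ (reads f p.1 || reads f p.2) ->
  peval r (setA s f i q) p = peval r s p.
Proof. by rewrite negb_or => /andP[h1 h2]; rewrite /peval !reval_setA. Qed.

Lemma eval_set_pair r s f fc e p : ~~ reads fc p.1 ->
  eval (set_pair f fc e p) r s =
  setA (setA s fc (neval r e) (peval r s p).2) f (neval r e) (peval r s p).1.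
Proof. by move=> h; rewrite /= reval_setA. Qed.

(* [X] is the input from cell 3 on, [SJ] the codes of the resultants of the
   constraints, [UNS] the [unset] flags, and a final [c] marks the codes that go
   with an array of costs. *)
Local Notation X := 0%N.
Local Notation OUT := 1%N.
Local Notation POW := 2%N.
Local Notation CODE := 3%N.
Local Notation SJ := 4%N.
Local Notation DEP := 5%N.
Local Notation UNS := 6%N.
Local Notation DEG := 7%N.
Local Notation DEAD := 8%N.
Local Notation "'F0" := 9%N.
Local Notation "'F1" := 10%N.
Local Notation "'G0" := 11%N.
Local Notation "'G1" := 12%N.
Local Notation "'F0c" := 13%N.
Local Notation "'F1c" := 14%N.
Local Notation "'G0c" := 15%N.
Local Notation "'G1c" := 16%N.
Local Notation "'K" := 17%N.
Local Notation "'Kc" := 18%N.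
Local Notation var := NVar.
Local Notation mat i j := (NAdd (NMul i (var 1)) j).

Definition incr (f : nat) (e : nexp) (q : rexp) : cmd := Set_ f e (RAdd (RArr f e) q).

Definition codes : cmd :=
  Seq (Set_ POW (NConst 0) (RConst 1))
  (Seq (For 2 0 (Set_ POW (NAdd (var 2) (NConst 1)) (RMul (RConst 2^-1) (RArr POW (var 2)))))
       (For 2 1 (For 3 0 (incr CODE (var 2)
          (RMul (RArr X (NAdd (var 1) (NAdd (NMul (var 2) (var 0)) (var 3)))) (RArr POW (var 3))))))).

Definition in_constraint (j k : nexp) : rexp :=
  (RArr X (NAdd (NAdd (var 1) (NMul (var 1) (var 0))) (mat j k))).

Definition rnot (e : rexp) : rexp := RSub (RConst 1) e.
Definition requal (a b : rexp) : rexp := RMul (rnot (RLt a b)) (rnot (RLt b a)).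

(** The outer loop runs to [N], a permitted bound, and the test cuts it off at [|C|]. Comparing sums
    of codes replaces a comparison of incidence rows, which would cost another factor [n]. *)
Definition rows : cmd :=
  For 2 1 (If (RLt (RNat (NAdd (var 2) (var 0))) (RNat (var 1)))
    (Seq (For 3 1 (incr SJ (var 2) (RMul (in_constraint (var 2) (var 3)) (RArr CODE (var 3)))))
         (Find 3 1 (requal (RArr CODE (var 4)) (RArr SJ (var 2)))
            (Seq (incr UNS (var 3) (RConst 1))
                 (For 4 1 (incr DEP (mat (var 3) (var 4)) (in_constraint (var 2) (var 4)))))))
    Skip).

Definition degrees : cmd :=
  For 2 1 (Seq (Set_ 'G1 (var 2) (RArr X (var 2)))
          (Seq (Set_ 'G1c (var 2) (RMul (RArr CODE (var 2)) (rnot (RArr UNS (var 2)))))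
               (For 3 1 (incr DEG (var 2)
                  (RAdd (RArr DEP (mat (var 2) (var 3))) (RArr DEP (mat (var 3) (var 2)))))))).

Definition Fexp (b : bool) (e : nexp) : pexp :=
  if b then (RArr 'F1 e, RArr 'F1c e) else (RArr 'F0 e, RArr 'F0c e).
Definition Gexp (b : bool) (e : nexp) : pexp :=
  if b then (RArr 'G1 e, RArr 'G1c e) else (RArr 'G0 e, RArr 'G0c e).
Definition Kexp : pexp := (RArr 'K (NConst 0), RArr 'Kc (NConst 0)).
Definition leaf_exp (b b' : bool) : pexp := padd (Fexp b (var 3)) (Gexp b' (var 3)).

Definition finish : cmd :=
  set_pair 'K 'Kc (NConst 0) (padd Kexp (pminE (leaf_exp false false) (leaf_exp true true))).

(** The order matters: the new ['F0] needs the old ['F1] and the old flag, so these are overwritten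
    after it. *)
Definition to_parent : cmd :=
  Seq (set_pair 'F0 'F0c (var 4)
    (pif (RLt (RConst 0) (RArr UNS (var 4)))
       (padd (Fexp true (var 4)) (leaf_exp false false))
       (pminE (padd (Fexp false (var 4)) (leaf_exp false false))
          (pminE (padd (Fexp false (var 4)) (leaf_exp true true))
                 (padd (Fexp true (var 4)) (leaf_exp false false))))))
  (Seq (set_pair 'F1 'F1c (var 4) (padd (Fexp true (var 4)) (leaf_exp true true)))
  (Seq (Set_ UNS (var 4) (RConst 0))
       (incr DEG (var 4) (RConst (-1))))).

Definition to_child : cmd :=
  Seq (set_pair 'G0 'G0c (var 4)
    (padd (Gexp false (var 4)) (pminE (leaf_exp false false) (leaf_exp true false))))
  (Seq (set_pair 'G1 'G1c (var 4)
    (padd (Gexp true (var 4)) (pminE (leaf_exp false false) (leaf_exp true true))))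
  (incr DEG (var 4) (RConst (-1)))).

Definition pass_on : cmd :=
  If (RLt (RArr DEAD (var 4)) (RConst 1))
    (If (RArr DEP (mat (var 4) (var 3))) to_parent
       (If (RArr DEP (mat (var 3) (var 4))) to_child Skip))
    Skip.

Definition round : cmd :=
  Find 3 1 (RMul (RLt (RArr DEAD (var 4)) (RConst 1)) (RLt (RArr DEG (var 4)) (RConst 2%:R)))
    (Seq (Set_ DEAD (var 3) (RConst 1))
         (If (RLt (RArr DEG (var 3)) (RConst 1)) finish (For 4 1 pass_on))).

Definition decode : cmd :=
  Seq (Set_ OUT (NConst 0) (RArr 'K (NConst 0)))
      (For 2 0 (Seq (Set_ OUT (NAdd (var 2) (NConst 1)) (rnot (RLt (RArr 'Kc (NConst 0)) (RArr POW (var 2)))))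
                    (Set_ 'Kc (NConst 0) (RSub (RArr 'Kc (NConst 0))
                       (RMul (RArr OUT (NAdd (var 2) (NConst 1))) (RArr POW (var 2))))))).

Definition program : cmd :=
  Seq codes (Seq rows (Seq degrees (Seq (For 2 1 round) decode))).

Lemma program_wf : cwf 2 program. Proof. by []. Qed.
Lemma program_depth : (depth program <= 2)%N. Proof. by []. Qed.

(** * Loops *)

Lemma loop_ind (I : nat -> arrays -> Prop) body k s :
  I 0%N s -> (forall i s, (i < k)%N -> I i s -> I i.+1 (body i s)) -> I k (loop body k s).
Proof.
move=> I0 h; elim: k h => [|k IH] h; first by [].
by rewrite loopS; apply: (h k) => //; apply: IH => i s' lt; apply: h; apply: ltnW.
Qed.

(** Meant for a loop over all nodes in which only the unique neighbour [v] is touched; the other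
    indices must idle both before and after the change made at [v]. *)
Lemma loop_single body k v s : (v < k)%N ->
  (forall i, (i < k)%N -> i != v -> body i s = s) ->
  (forall i, (i < k)%N -> i != v -> body i (body v s) = body v s) ->
  loop body k s = body v s.
Proof.
move=> vk h1 h2; suff e i : (i <= k)%N -> loop body i s = if (i <= v)%N then s else body v s.
  by rewrite e // leqNgt vk.
elim: i => // i IH lt; rewrite loopS IH ?(ltnW lt) //.
by case: (ltngtP i v) => [iv|iv|->] //; [apply: h1 | apply: h2]; rewrite // neq_ltn iv ?orbT.
Qed.

(** The summand may read the state, but only arrays that the accumulation leaves alone, so it can be
    evaluated in the initial state. *)
Lemma loop_sum f j0 (g : nat -> arrays -> rat) (g0 : nat -> rat) k s :
  (forall i s', (i < k)%N -> (forall h j, h != f -> s' h j = s h j) -> g i s' = g0 i) ->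
  forall h j, loop (fun i s => setA s f j0 (s f j0 + g i s)) k s h j =
    if (h == f) && (j == j0) then s f j0 + \sum_(i < k) g0 i else s h j.
Proof.
elim: k => [|k IH] hg h j.
  by rewrite big_ord0 addr0 /loop /=; case: andP => [[/eqP -> /eqP ->]|].
have {}IH := IH (fun i s' lt => hg i s' (ltnW lt)).
rewrite loopS /setA !IH !eqxx /= (hg k) //; last first.
  by move=> h' j' /negbTE ne; rewrite IH ne.
by rewrite big_ord_recr /= addrA; case: ((h == f) && (j == j0)).
Qed.

Lemma find_last_spec (p : nat -> bool) k :
  (exists2 i, (i < k)%N & p i) ->
  let x := find_last (fun _ => p) k in (x < k)%N /\ p x.
Proof.
elim: k => [[] //|k IH] [i ik pi]; rewrite /= find_lastS.
case: ifP => [//|npk].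
have /IH[lt px] : exists2 i, (i < k)%N & p i.
  exists i => //; rewrite ltn_neqAle -ltnS ik andbT.
  by apply: contraTneq pi => ->; rewrite npk.
by split=> //; apply: ltnW.
Qed.

Lemma loop_row f c (g : nat -> arrays -> rat) (g0 : nat -> rat) k s :
  (forall i s', (i < k)%N -> (forall h j, h != f -> s' h j = s h j) -> g i s' = g0 i) ->
  forall h j, loop (fun i s => setA s f (c + i) (s f (c + i)%N + g i s)) k s h j =
    if (h == f) && (c <= j < c + k)%N then s f j + g0 (j - c)%N else s h j.
Proof.
elim: k => [|k IH] hg h j.
  by rewrite addn0 /loop /=; case: ifP => //; lia.
have {}IH := IH (fun i s' lt => hg i s' (ltnW lt)).
rewrite loopS /setA !IH !eqxx /= (hg k) //; last first.
  by move=> h' j' /negbTE ne; rewrite IH ne.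
case: (h == f) => //=; case: (j =P (c + k)%N) => [->|ne].
  have -> : (c <= c + k < c + k)%N = false by lia.
  have -> : (c <= c + k < c + k.+1)%N by lia.
  by congr (_ + g0 _); lia.
by have -> : (c <= j < c + k.+1)%N = (c <= j < c + k)%N by lia.
Qed.

Lemma row_index N r k l : (l < N)%N -> (r * N <= k * N + l < r * N + N)%N = (k == r).
Proof.
move=> lN; apply/idP/eqP => [/andP[h1 h2]|->]; last by lia.
have : (r < k.+1)%N by rewrite -(ltn_pmul2r (m := N)) ?mulSn; lia.
have : (k < r.+1)%N by rewrite -(ltn_pmul2r (m := N)) ?mulSn; lia.
lia.
Qed.

Lemma gt0_bool (b : bool) : (0 < (b : nat)%:R :> rat) = b.
Proof. by case: b; rewrite ?ltr01 ?ltxx. Qed.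

Lemma requal_gt0 (a b : rat) :
  (0 < (1 - ((a < b)%R : nat)%:R) * (1 - ((b < a)%R : nat)%:R) :> rat) = (a == b).
Proof. by case: (ltgtP a b) => h /=; rewrite ?subrr ?subr0 ?mul0r ?mulr0 ?mulr1 ?ltxx. Qed.

(** * Correctness of the preprocessing *)

Section Verification.
Variables (n : nat) (M : {set {set 'I_n}}) (C : {set {set {set 'I_n}}}).
Variable a : {set 'I_n} -> rat.
Hypothesis lin : is_linearization M C.
Hypothesis cons : consistent M C.
Hypothesis simp : simple_lin M C.
Hypothesis acyc : acyclic_G M C.

Local Notation N := #|M|.
Local Notation mono := (mono M).
Local Notation r0 := (env0 n N).
Let con j := nth set0 (enum C) j.

Lemma encode_coef k : (k < N)%N -> encode M C a (k + 3)%N = a (mono k).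
Proof.
move=> kN; rewrite /encode; do 3!(rewrite ifN; last lia).
have -> : (k + 3 < 3 + N)%N by lia.
by rewrite addnK.
Qed.

Lemma encode_bit k i : (k < N)%N -> (i < n)%N ->
  encode M C a (N + (k * n + i) + 3)%N = (bit (mono k) i : nat)%:R.
Proof.
move=> kN iN; rewrite /encode; do 3!(rewrite ifN; last lia).
have -> : (N + (k * n + i) + 3 < 3 + N)%N = false by lia.
have -> : (N + (k * n + i) + 3 < 3 + N + N * n)%N.
  have : (k.+1 * n <= N * n)%N by rewrite leq_mul2r kN orbT.
  by rewrite mulSn; lia.
have -> : (N + (k * n + i) + 3 - (3 + N) = k * n + i)%N by lia.
by rewrite divnMDl ?divn_small ?addn0 ?modnMDl ?modn_small //; lia.
Qed.

Lemma encode_constraint j k : (j < #|C|)%N -> (k < N)%N ->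
  encode M C a (N + N * n + (j * N + k) + 3)%N = ((mono k \in con j) : nat)%:R.
Proof.
move=> jC kN; rewrite /encode; do 3!(rewrite ifN; last lia).
have -> : (N + N * n + (j * N + k) + 3 < 3 + N)%N = false by lia.
have -> : (N + N * n + (j * N + k) + 3 < 3 + N + N * n)%N = false by lia.
have -> : (N + N * n + (j * N + k) + 3 < 3 + N + N * n + #|C| * N)%N.
  have : (j.+1 * N <= #|C| * N)%N by rewrite leq_mul2r jC orbT.
  by rewrite mulSn; lia.
have -> : (N + N * n + (j * N + k) + 3 - (3 + N + N * n) = j * N + k)%N by lia.
by rewrite divnMDl ?divn_small ?addn0 ?modnMDl ?modn_small //; lia.
Qed.

(** Since [|C| + n = N], the input ends at cell [3 + N + N * N], below the square of [N + NREG]. *)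
Lemma encode_end p : ((N + NREG) * (N + NREG) <= p)%N -> encode M C a p = 0.
Proof.
have e := card_MC lin simp; rewrite /NREG => le.
have le2 : (3 + N + N * n + #|C| * N <= p)%N.
  have : (N * n + #|C| * N = N * N)%N by rewrite -{4}e mulnDr addnC [(N * #|C|)%N]mulnC.
  by move: le; nia.
have p3 : (2 < p)%N by lia.
by rewrite /encode; do 6!(rewrite ifN; last by rewrite -?leqNgt; lia).
Qed.

Definition coded (s : arrays) : Prop :=
  [/\ forall j, s X j = encode M C a (j + 3)%N,
      forall i, (i <= n)%N -> s POW i = weight i &
      forall k, (k < N)%N -> s CODE k = code (mono k)].

Lemma codes_ok : let s := eval codes r0 (arrays0 (encode M C a)) in
  coded s /\ forall h j, ~~ (h \in [:: X; POW; CODE]) -> s h j = 0.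
Proof.
pose s0 := setA (arrays0 (encode M C a)) POW 0 1.
pose b1 i s := setA s POW (i + 1) (2^-1 * s POW i).
pose b2 k := loop (fun i s => setA s CODE k
  (s CODE k + s X (N + (k * n + i))%N * s POW i)) n.
pose s1 := loop b1 n s0; pose s2 := loop b2 N s1.
rewrite (_ : eval codes r0 _ = s2) //=.
have [p1 q1] : (forall j, (j <= n)%N -> s1 POW j = weight j) /\
    (forall h j, h != POW -> s1 h j = arrays0 (encode M C a) h j).
  apply: (@loop_ind (fun i s => (forall j, (j <= i)%N -> s POW j = weight j) /\
    (forall h j, h != POW -> s h j = arrays0 (encode M C a) h j))).
    split=> [[|]|h j] //.
    by rewrite /s0 /setA => /negbTE ->.
  move=> i s lt [h1 h2]; rewrite /b1; split=> [j le|h j hn].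
    rewrite /setA /=; case: (j =P (i + 1)%N) => [->|ne].
      by rewrite h1 // addn1 /weight exprS.
    by apply: h1; lia.
  by rewrite /setA (negbTE hn); apply: h2.
have [p2 q2] : (forall j, s2 CODE j = if (j < N)%N then code (mono j) else 0) /\
    (forall h j, h != CODE -> s2 h j = s1 h j).
  apply: (@loop_ind (fun k s => (forall j, s CODE j = if (j < k)%N then code (mono j) else 0) /\
    (forall h j, h != CODE -> s h j = s1 h j))).
    by split=> // j; rewrite q1.
  move=> k s kN [h1 h2].
  have e : forall h j, b2 k s h j = if (h == CODE) && (j == k) then
      s CODE k + \sum_(i < n) (bit (mono k) i : nat)%:R * weight i else s h j.
    apply: (@loop_sum CODE k (fun i s => s X (N + (k * n + i))%N * s POW i)
      (fun i => (bit (mono k) i : nat)%:R * weight i)) => i s' iN hs.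
    rewrite !hs // !h2 // p1; last exact: ltnW.
    by rewrite q1 // /arrays0 encode_bit.
  split=> [j|h j hn]; rewrite e; last by rewrite (negbTE hn) /= h2.
  rewrite /= !h1.
  case: (j =P k) => [->|ne].
    by rewrite ltnn ltnSn add0r codeE /tail big_mkord.
  by have -> : (j < k.+1)%N = (j < k)%N by lia.
split; first split.
- by move=> j; rewrite q2 // q1.
- by move=> i le; rewrite q2 // p1.
- by move=> k kN; rewrite p2 kN.
move=> h j; rewrite !inE !negb_or => /and3P[h1 h2 h3].
by rewrite q2 // q1 //; case: h h1 {h2 h3}.
Qed.

Lemma coded_frame s s' : (forall h j, h \in [:: X; POW; CODE] -> s' h j = s h j) ->
  coded s -> coded s'.
Proof.
by move=> e [h1 h2 h3]; split=> *; rewrite e ?h1 ?h2 ?h3.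
Qed.
Let names j k := (j < #|C|)%N && (resultant (con j) == mono k).

Definition rows_inv (j0 : nat) (s : arrays) : Prop :=
  [/\ coded s,
      forall k, (k < N)%N -> s UNS k = \sum_(j < j0) (names j k : nat)%:R,
      forall k l, (k < N)%N -> (l < N)%N -> s DEP (k * N + l)%N =
        \sum_(j < j0) ((names j k && (mono l \in con j)) : nat)%:R,
      forall j, (j0 <= j)%N -> s SJ j = 0 &
      forall h j, ~~ (h \in [:: X; POW; CODE; SJ; DEP; UNS]) -> s h j = 0].

Let same (s : arrays) (j i : nat) : bool := 0 < (1 - ((s CODE i < s SJ j)%R : nat)%:R) *
  (1 - ((s SJ j < s CODE i)%R : nat)%:R) :> rat.

Let row_step (j : nat) (s : arrays) : arrays :=
  if 0 < (((j + n)%:R < N%:R :> rat)%R : nat)%:R :> rat then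
    let s1 := loop (fun k s => setA s SJ j
      (s SJ j + s X (N + N * n + (j * N + k))%N * s CODE k)) N s in
    let r := find_last (fun _ => same s1 j) N in
    loop (fun l s => setA s DEP (r * N + l)
      (s DEP (r * N + l)%N + s X (N + N * n + (j * N + l))%N)) N
      (setA s1 UNS r (s1 UNS r + 1))
  else s.

Lemma con_in j : (j < #|C|)%N -> con j \in C.
Proof. by move=> lt; rewrite -mem_enum mem_nth // -cardE. Qed.

Lemma row_step_ok j s : (j < N)%N -> rows_inv j s -> rows_inv j.+1 (row_step j s).
Proof.
move=> jN [cs hU hD hS h0]; rewrite /row_step gt0_bool ltr_nat.
have cMC := card_MC lin simp.
have [jC|jC] := ltnP (j + n) N; last first.
  have nj k : names j k = false by rewrite /names; have -> : (j < #|C|)%N = false by lia.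
  split=> //.
  - by move=> k kN; rewrite big_ord_recr /= nj addr0 hU.
  - by move=> k l kN lN; rewrite big_ord_recr /= nj addr0 hD.
  - by move=> i le; apply: hS; apply: ltnW.
have {}jC : (j < #|C|)%N by lia.
have [cX cP cC] := cs.
have [_ [_ l3]] := lin; have [/subsetP cM rM] := l3 _ (con_in jC).
set s1 := loop _ N s.
have e1 : forall h i, s1 h i = if (h == SJ) && (i == j)
    then s SJ j + \sum_(k < N) (mono k \in con j : nat)%:R * code (mono k) else s h i.
  apply: (@loop_sum SJ j (fun k s => s X (N + N * n + (j * N + k))%N * s CODE k)
    (fun k => (mono k \in con j : nat)%:R * code (mono k))) => k s' kN hs.
  by rewrite !hs // cX cC // encode_constraint.
have s1S : s1 SJ j = code (resultant (con j)).
  rewrite e1 !eqxx hS // add0r (code_resultant lin cons simp acyc (con_in jC)).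
  rewrite (sum_mono M (fun m => (m \in con j : nat)%:R * code m)).
  rewrite [RHS]big_mkcond [LHS]big_mkcond /=; apply: eq_bigr => m _.
  have [mc|mc] := boolP (m \in con j); first by rewrite cM // mul1r.
  by rewrite mul0r if_same.
have s1E h i : h != SJ -> s1 h i = s h i by move=> /negbTE hn; rewrite e1 hn.
have [k0 ek0] := mono_surj rM.
(* Codes are injective and monomials are listed without repetition, so the search has exactly one
   hit. *)
have sameE i : (i < N)%N -> same s1 j i = (i == k0).
  move=> iN; rewrite /same requal_gt0 s1S s1E // cC // -ek0.
  by apply/eqP/eqP => [/code_inj/monomial_inj->//|->//].
move=> /=; set r := find_last _ N.
have -> : r = k0.
  have [|rN] := @find_last_spec (same s1 j) N; first by exists (nat_of_ord k0); rewrite ?sameE ?eqxx ?ltn_ord.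
  by rewrite sameE // => /eqP.
set s2 := setA _ _ _ _.
set s3 := loop _ N s2.
have e3 : forall h i, s3 h i =
    if (h == DEP) && (k0 * N <= i < k0 * N + N)%N
    then s2 DEP i + s2 X (N + N * n + (j * N + (i - k0 * N)))%N else s2 h i.
  apply: (@loop_row DEP (k0 * N) (fun l s => s X (N + N * n + (j * N + l))%N)
    (fun l => s2 X (N + N * n + (j * N + l))%N)) => l s' lN hs.
  by rewrite hs.
have s2E h i : h != UNS -> s2 h i = s1 h i by rewrite /s2 /setA => /negbTE ->.
have namesE k : (k < N)%N -> names j k = (k == k0).
  move=> kN; rewrite /names jC -ek0 /=.
  by apply/eqP/eqP => [/monomial_inj->//|->].
split.
- apply: coded_frame cs => h i; rewrite !inE => hh.
  have ne : [&& h != DEP, h != UNS & h != SJ] by move: hh => /or3P[] /eqP ->.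
  have /and3P[n1 n2 n3] := ne.
  by rewrite e3 (negbTE n1) /= s2E // s1E.
- move=> k kN; rewrite e3 /= /s2 /setA /= big_ord_recr /= namesE //.
  case: eqP => [->|_]; last by rewrite addr0 s1E // hU.
  by rewrite s1E // hU.
- move=> k l kN lN; rewrite e3 /= row_index // big_ord_recr /= namesE // -hD //.
  case: eqP => [->|_]; last by rewrite addr0 s2E // s1E.
  rewrite !s2E // !s1E // cX; congr (_ + _).
  have -> : (k0 * N + l - k0 * N = l)%N by lia.
  by rewrite encode_constraint.
- move=> i ji; rewrite e3 /= s2E // e1.
  have -> : (i == j) = false by lia.
  by rewrite andbF; apply: hS; apply: ltnW.
- move=> h i hh; have hh' := hh; rewrite !inE !negb_or in hh'.
  case/and5P: hh' => [_ _ _ n3 /andP[n1 n2]].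
  by rewrite e3 (negbTE n1) /= s2E // s1E // h0.
Qed.

Lemma sum_con (Q : pred {set {set 'I_n}}) :
  \sum_(j < N) (((j < #|C|)%N && Q (con j)) : nat)%:R = #|[set c in C | Q c]|%:R :> rat.
Proof.
have le : (#|C| <= N)%N by rewrite -(card_MC lin simp) leq_addr.
rewrite -natr_sum; congr _%:R; rewrite -[RHS]sum1_card [RHS]big_mkcond.
rewrite (eq_bigr (fun j : 'I_N => if (j < #|C|)%N then Q (con j) : nat else 0%N)); last first.
  by move=> j _; case: ifP.
rewrite -[LHS]big_mkcond /= -(big_ord_widen _ (fun j => Q (con j) : nat) le).
transitivity (\sum_(c in C) (Q c : nat))%N.
  by rewrite -[RHS]big_enum (big_nth set0) -cardE big_mkord.
by rewrite big_mkcond; apply: eq_bigr => c _; rewrite inE; case: (c \in C); case: (Q c).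
Qed.

Lemma rows_ok s : coded s -> (forall h j, ~~ (h \in [:: X; POW; CODE]) -> s h j = 0) ->
  let s' := eval rows r0 s in
  [/\ coded s',
      forall k, (k < N)%N -> s' UNS k = (nonsingle (mono k) : nat)%:R,
      forall k l, (k < N)%N -> (l < N)%N -> s' DEP (k * N + l)%N =
        (arc M C (mono k) (mono l) : nat)%:R &
      forall h j, ~~ (h \in [:: X; POW; CODE; SJ; DEP; UNS]) -> s' h j = 0].
Proof.
move=> cs h0; rewrite (_ : eval rows r0 s = loop row_step N s) //=.
have [] : rows_inv N (loop row_step N s).
  apply: loop_ind => [|j s' jN]; last exact: row_step_ok.
  split=> //.
  - by move=> k kN; rewrite big_ord0 h0.
  - by move=> k l kN lN; rewrite big_ord0 h0.
  - by move=> j _; rewrite h0.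
  - by move=> h j hh; apply: h0; apply: contraNN hh; rewrite !inE => /or3P[] ->; rewrite ?orbT.
move=> cs' hU hD _ h0'; split=> //.
- move=> k kN; rewrite hU // (sum_con (fun c => resultant c == mono k)); congr _%:R.
  have [ns|ns] := boolP (nonsingle (mono k)); first by rewrite simp.1 // mono_in.
  apply/eqP; rewrite cards_eq0; apply/eqP/setP => c; rewrite !inE.
  apply/negP => /andP[cC /eqP e]; move: ns; rewrite -e.
  by rewrite (resultant_nonsingle simp cC).
- move=> k l kN lN; rewrite hD //.
  have := sum_con (fun c => (resultant c == mono k) && (mono l \in c)).
  under eq_bigr do rewrite andbA; rewrite /names => ->; congr _%:R.
  have [/arcP[c cC [cm lc]]|na] := boolP (arc M C (mono k) (mono l)).
    apply/eqP/cards1P; exists c; apply/setP => c'; rewrite !inE.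
    apply/and3P/eqP => [[c'C /eqP e _]|->]; last by rewrite cC cm eqxx.
    by apply: (same_constraint lin simp) => //; rewrite e.
  apply/eqP; rewrite cards_eq0; apply/eqP/setP => c; rewrite !inE.
  apply/negP => /and3P[cC /eqP e lc]; case/negP: na; apply/arcP.
  by exists c.
Qed.

Definition degrees_inv (k0 : nat) (s s' : arrays) : Prop :=
  (forall h j, ~~ (h \in [:: DEG; 'G1; 'G1c]) -> s' h j = s h j) /\
  (forall k, (k < N)%N -> [/\
     s' 'G1 k = (if (k < k0)%N then a (mono k) else 0),
     s' 'G1c k = (if (k < k0)%N && ~~ nonsingle (mono k) then code (mono k) else 0) &
     s' DEG k = if (k < k0)%N then \sum_(l < N)
       ((arc M C (mono k) (mono l) : nat)%:R + (arc M C (mono l) (mono k) : nat)%:R) else 0]).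

Lemma degrees_ok s : coded s ->
  (forall k, (k < N)%N -> s UNS k = (nonsingle (mono k) : nat)%:R) ->
  (forall k l, (k < N)%N -> (l < N)%N -> s DEP (k * N + l)%N =
        (arc M C (mono k) (mono l) : nat)%:R) ->
  (forall h j, ~~ (h \in [:: X; POW; CODE; SJ; DEP; UNS]) -> s h j = 0) ->
  degrees_inv N s (eval degrees r0 s).
Proof.
move=> [cX cP cC] hU hD h0.
pose body k (s : arrays) := loop (fun l s => setA s DEG k
   (s DEG k + (s DEP (k * N + l)%N + s DEP (l * N + k)%N))) N
   (setA (setA s 'G1 k (s X k)) 'G1c k (s CODE k * (1 - s UNS k))).
rewrite (_ : eval degrees r0 s = loop body N s) //.
apply: (@loop_ind (fun k s' => degrees_inv k s s')) => [|k0 s' kN [hs hk]].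
  by split=> // k kN; rewrite !h0 // ltn0.
rewrite /body; set s1 := setA (setA _ _ _ _) _ _ _.
set g := fun l : nat => (arc M C (mono k0) (mono l) : nat)%:R +
  (arc M C (mono l) (mono k0) : nat)%:R : rat.
set s2 := loop _ N s1.
have s1E h j : ~~ (h \in [:: 'G1; 'G1c]) -> s1 h j = s' h j.
  by rewrite !inE negb_or /s1 /setA => /andP[/negbTE -> /negbTE ->].
have e2 : forall h j, s2 h j =
    if (h == DEG) && (j == k0) then s1 DEG k0 + \sum_(l < N) g l else s1 h j.
  apply: (@loop_sum DEG k0 (fun l s => s DEP (k0 * N + l)%N + s DEP (l * N + k0)%N) g).
  by move=> l s3 lN h3; rewrite !h3 // !s1E // !hs // !hD.
split.
  move=> h j hh; have hh' := hh; rewrite !inE !negb_or in hh'.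
  case/and3P: hh' => [n1 n2 n3].
  by rewrite e2 (negbTE n1) /= s1E ?hs // !inE negb_or n2.
move=> k lt; have [h1 h2 h3] := hk k lt; rewrite !e2 /= (s1E DEG k0) // (s1E DEG k) //.
case: (k =P k0) => [e|ne].
  rewrite e ltnn in h3; rewrite e ltnSn h3 add0r; split=> //.
  - by rewrite /s1 /setA /= eqxx hs // cX encode_coef.
  - rewrite /s1 /setA /= eqxx hs // cC // hs // hU //.
    by case: (nonsingle _); rewrite /= ?subrr ?mulr0 ?subr0 ?mulr1.
have -> : (k < k0.+1)%N = (k < k0)%N by lia.
have nk : (k == k0) = false by apply/eqP.
by rewrite /s1 /setA /= nk h1 h2 h3; split.
Qed.

End Verification.

Definition rowF (s : arrays) (k : nat) (b : bool) : rat * rat :=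
  if b then (s 'F1 k, s 'F1c k) else (s 'F0 k, s 'F0c k).
Definition rowG (s : arrays) (k : nat) (b : bool) : rat * rat :=
  if b then (s 'G1 k, s 'G1c k) else (s 'G0 k, s 'G0c k).

Definition tables_of (N : nat) (s : arrays) : tables 'I_N :=
  @Tables 'I_N (fun k : 'I_N => s DEAD k < 1) (fun k : 'I_N => 0 < s UNS k)
    (fun k : 'I_N => rowF s k) (fun k : 'I_N => rowG s k) (s 'K 0%N, s 'Kc 0%N).

Lemma peval_F r s b e : peval r s (Fexp b e) = rowF s (neval r e) b.
Proof. by case: b. Qed.

Lemma peval_G r s b e : peval r s (Gexp b e) = rowG s (neval r e) b.
Proof. by case: b. Qed.

Lemma peval_leaf r s b b' :
  peval r s (leaf_exp b b') = rowF s (r 3%N) b + rowG s (r 3%N) b'.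
Proof. by case: b; case: b'. Qed.

Lemma finish_eq r s : let p := (s 'K 0%N, s 'Kc 0%N) +
    pmin (rowF s (r 3%N) false + rowG s (r 3%N) false)
         (rowF s (r 3%N) true + rowG s (r 3%N) true) in
  eval finish r s = setA (setA s 'Kc 0 p.2) 'K 0 p.1.
Proof. by rewrite /finish eval_set_pair // peval_add peval_min !peval_leaf. Qed.

Lemma to_parent_eq r s : let u := r 3%N in let v := r 4%N in
  let h b := rowF s u b + rowG s u b in
  let p := if 0 < s UNS v then rowF s v true + h false
     else pmin (rowF s v false + h false)
       (pmin (rowF s v false + h true) (rowF s v true + h false)) in
  let q := rowF s v true + h true in
  eval to_parent r s = setA (setA (setA (setA (setA (setA s 'F0c v p.2) 'F0 v p.1)
    'F1c v q.2) 'F1 v q.1) UNS v 0) DEG v (s DEG v + -1).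
Proof.
move=> u v h p q; rewrite /to_parent.
set c1 := set_pair 'F0 _ _ _; set c2 := set_pair 'F1 _ _ _.
have -> : eval (Seq c1 (Seq c2 (Seq (Set_ UNS (var 4) (RConst 0))
    (incr DEG (var 4) (RConst (-1)))))) r s =
  (let s2 := eval c2 r (eval c1 r s) in
   setA (setA s2 UNS v 0) DEG v (s2 DEG v + -1)) by [].
rewrite /c1 /c2 eval_set_pair // eval_set_pair //.
rewrite (@peval_setA r _ 'F0) // (@peval_setA r _ 'F0c) //.
by rewrite peval_if !peval_min !peval_add !peval_F !peval_G.
Qed.

Lemma to_child_eq r s : r 3%N != r 4%N -> let u := r 3%N in let v := r 4%N in
  let p b := rowG s v b +
    pmin (rowF s u false + rowG s u false) (rowF s u true + rowG s u b) in
  eval to_child r s = setA (setA (setA (setA (setA s 'G0c v (p false).2) 'G0 v (p false).1)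
    'G1c v (p true).2) 'G1 v (p true).1) DEG v (s DEG v + -1).
Proof.
move=> uv u v p; rewrite /to_child.
set c1 := set_pair 'G0 _ _ _; set c2 := set_pair 'G1 _ _ _.
have -> : eval (Seq c1 (Seq c2 (incr DEG (var 4) (RConst (-1))))) r s =
  (let s2 := eval c2 r (eval c1 r s) in setA s2 DEG v (s2 DEG v + -1)) by [].
rewrite /c1 /c2 eval_set_pair // eval_set_pair //.
rewrite !peval_add !peval_min !peval_leaf !peval_G.
have e x y b : rowG (setA (setA s 'G0c v x) 'G0 v y) u b = rowG s u b.
  by rewrite /rowG /setA /= (negbTE uv); case: b.
by rewrite -/u -/v !e.
Qed.

Section Rounds.
Variables (n : nat) (M : {set {set 'I_n}}) (C : {set {set {set 'I_n}}}).
Variable a : {set 'I_n} -> rat.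
Hypothesis lin : is_linearization M C.
Hypothesis cons : consistent M C.
Hypothesis simp : simple_lin M C.
Hypothesis acyc : acyclic_G M C.

Local Notation N := #|M|.
Local Notation r0 := (env0 n N).
Local Notation dep := (@dep n M C).
Local Notation tab := (tables_of N).
Local Notation adj k l := (dep k l || dep l k).

Definition neighbours (s : arrays) (k : 'I_N) : pred 'I_N :=
  [pred l | alive (tab s) l && adj k l].

Definition round_inv (t : nat) (s : arrays) : Prop :=
  [/\ represents C a (tab s),
      (#|[pred k | alive (tab s) k]| + t = N)%N,
      (forall k l : 'I_N, s DEP (k * N + l)%N = (dep k l : nat)%:R) /\
      (forall i, (i <= n)%N -> s POW i = weight i),
      forall k, alive (tab s) k -> s DEG k = #|neighbours s k|%:R &
      forall k, alive (tab s) k -> unset (tab s) k ->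
        nonsingle (mono M k) /\ forall l, dep k l -> alive (tab s) l].

Lemma round_inv_next t s s' (u : 'I_N) :
  round_inv t s -> alive (tab s) u ->
  (forall k, alive (tab s') k = alive (tab s) k && (k != u)) ->
  (forall j, s' DEP j = s DEP j) -> (forall j, s' POW j = s POW j) ->
  (forall k, alive (tab s') k -> s' DEG k = s DEG k - (adj u k : nat)%:R) ->
  (forall k, alive (tab s') k -> unset (tab s') k -> unset (tab s) k && ~~ dep k u) ->
  refines dep (tab s) (tab s') -> round_inv t.+1 s'.
Proof.
move=> [rp ct [hD hP] hG hU] au al' eD eP eG eU rf; split.
- exact: represents_refines rp rf.
- have e : #|[pred k | alive (tab s) k]| = #|[pred k | alive (tab s') k]|.+1.
    rewrite (cardD1 u) inE au add1n; congr _.+1.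
    by apply: eq_card => k; rewrite !inE al' andbC.
  by rewrite addnS -addSn -e.
- by split=> *; rewrite ?eD ?eP; [apply: hD | apply: hP].
- move=> k ak; have /andP[ak0 ku] : alive (tab s) k && (k != u) by rewrite -al'.
  rewrite eG // hG // (cardD1 u) inE au /= orbC natrD addrAC subrr add0r; congr _%:R.
  by apply: eq_card => l; rewrite !inE al' andbA [(l != u) && _]andbC.
- move=> k ak uk; have /andP[uk0 nd] := eU k ak uk.
  have /andP[ak0 ku] : alive (tab s) k && (k != u) by rewrite -al'.
  have [ns ch] := hU k ak0 uk0; split=> // l dl; rewrite al' ch //=.
  by apply: contraNneq nd => <-.
Qed.

Lemma dep_asym (k l : 'I_N) : dep k l -> ~~ dep l k.
Proof. exact: (arc_asym lin cons simp). Qed.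

Lemma dep_irr (k : 'I_N) : ~~ dep k k.
Proof. by apply/negP => h; have := dep_asym h; rewrite h. Qed.

Lemma leaf_set t s (u : 'I_N) : round_inv t s -> alive (tab s) u ->
  (#|neighbours s u| <= 1)%N -> ~~ unset (tab s) u.
Proof.
move=> [_ _ _ _ hU] au le; apply/negP => uu; have [ns ch] := hU u au uu.
have [l1 [l2 [a1 a2 ne]]] := arc_two lin cons simp (mono_in (ltn_ord u)) ns.
have [_ m1 _ _ _] := arc_facts lin cons simp a1.
have [_ m2 _ _ _] := arc_facts lin cons simp a2.
have [k1 e1] := mono_surj m1; have [k2 e2] := mono_surj m2.
have d1 : dep u k1 by move: a1; rewrite -e1.
have d2 : dep u k2 by move: a2; rewrite -e2.
have /card_le1_eqP h := le.
have : k1 = k2 by apply: h; rewrite !inE ?d1 ?d2 ?ch.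
by move=> e; rewrite -e1 -e2 e eqxx in ne.
Qed.

Section OneRound.
Variables (t : nat) (s : arrays) (u : 'I_N).
Hypothesis inv : round_inv t s.
Hypothesis au : alive (tab s) u.
Hypothesis deg1 : (#|neighbours s u| <= 1)%N.
Let s1 := setA s DEAD u 1.
Let r : env := bind (bind r0 2 t) 3 u.

Lemma alive_s1 s' : (forall j, s' DEAD j = s1 DEAD j) ->
  forall k, alive (tab s') k = alive (tab s) k && (k != u).
Proof.
move=> e k; rewrite /= e /s1 /setA /= (_ : (nat_of_ord k == u) = (k == u)) //.
by case: (k == u); rewrite ?ltxx ?andbF ?andbT.
Qed.

Lemma finish_ok : #|neighbours s u| = 0%N -> round_inv t.+1 (eval finish r s1).
Proof.
move=> n0; have no k : alive (tab s) k -> adj u k = false.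
  by move=> ak; have := card0_eq n0 k; rewrite !inE ak.
rewrite finish_eq; set s' := setA _ 'K 0 _.
have al' := @alive_s1 s' (fun _ => erefl).
have as0 k : alive (tab s') k -> alive (tab s) k by rewrite al' => /andP[].
apply: (round_inv_next inv au al') => //.
- by move=> k /as0/no ->; rewrite subr0.
- move=> k /as0/no/negbT; rewrite negb_or => /andP[_ ->] uk; rewrite andbT; exact: uk.
- apply: (elim_isolated (u := u)) => //.
  + exact: leaf_set inv au deg1.
  + exact: dep_irr.
  + by move=> l /as0/no/negbT; rewrite negb_or.
Qed.

Variable v : 'I_N.
Hypothesis nv : neighbours s u =i pred1 v.

Lemma only_v k : alive (tab s) k -> adj u k = (k == v).
Proof. by move=> ak; have := nv k; rewrite !inE ak. Qed.

Lemma alive_v : alive (tab s) v && adj u v.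
Proof. by have := nv v; rewrite !inE eqxx. Qed.

Lemma pass_on_id s2 i : (i < N)%N -> i != v ->
  (forall j, s2 DEAD j = s1 DEAD j) -> (forall j, s2 DEP j = s DEP j) ->
  eval pass_on (bind r 4 i) s2 = s2.
Proof.
have [_ _ [hD _] _ _] := inv.
move=> iN ne e1 e2.
rewrite (_ : eval pass_on (bind r 4 i) s2 =
  if 0 < ((s2 DEAD i < 1)%R : nat)%:R :> rat then
    if 0 < s2 DEP (i * N + u)%N then eval to_parent (bind r 4 i) s2
    else if 0 < s2 DEP (u * N + i)%N then eval to_child (bind r 4 i) s2 else s2
  else s2) // gt0_bool.
case: ifP => // ai; pose k := Ordinal iN.
have ak : alive (tab s) k && (k != u) by rewrite -(alive_s1 e1).
have /andP[ak0 ku] := ak.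
have := only_v ak0; rewrite (_ : (k == v) = false); last by apply/negbTE.
move/negbT; rewrite negb_or => /andP[/negbTE d1 /negbTE d2].
by rewrite !e2 (hD k u) (hD u k) !gt0_bool d1 d2.
Qed.

Lemma pass_on_ok : round_inv t.+1 (loop (fun i => eval pass_on (bind r 4 i)) N s1).
Proof.
have [_ _ [hD _] _ _] := inv.
have /andP[av duv] := alive_v.
have vu : v != u by apply: contraTneq duv => ->; rewrite orbb dep_irr.
have su := leaf_set inv au deg1.
have iu := dep_irr u.
have nat_eq (k : 'I_N) : (nat_of_ord k == v) = (k == v) by [].
have bodyE : eval pass_on (bind r 4 v) s1 =
    if dep v u then eval to_parent (bind r 4 v) s1 else eval to_child (bind r 4 v) s1.
  rewrite (_ : eval pass_on (bind r 4 v) s1 =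
    if 0 < ((s1 DEAD v < 1)%R : nat)%:R :> rat then
      if 0 < s1 DEP (v * N + u)%N then eval to_parent (bind r 4 v) s1
      else if 0 < s1 DEP (u * N + v)%N then eval to_child (bind r 4 v) s1 else s1
    else s1) // gt0_bool.
  have -> : s1 DEAD v < 1.
    by have := @alive_s1 s1 (fun _ => erefl) v; rewrite /= => ->; rewrite vu andbT.
  rewrite [s1 DEP _](hD v u) [s1 DEP _](hD u v) !gt0_bool.
  by case: (dep v u) duv => //; rewrite orbF => ->.
have uv : bind r 4 v 3%N != bind r 4 v 4%N by rewrite /= /bind /= eq_sym.
rewrite (@loop_single _ N v) //; first last.
- move=> i iN ne; apply: pass_on_id => // j; rewrite bodyE.
    by case: ifP => _; rewrite ?to_parent_eq ?(to_child_eq _ uv).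
  by case: ifP => _; rewrite ?to_parent_eq ?(to_child_eq _ uv).
- by move=> i iN ne; apply: pass_on_id.
rewrite bodyE; have [dvu|ndvu] := boolP (dep v u).
  rewrite to_parent_eq /=; set s' := setA _ DEG _ _.
  have al' := @alive_s1 s' (fun _ => erefl).
  have as0 k : alive (tab s') k -> alive (tab s) k by rewrite al' => /andP[].
  have unE k : unset (tab s') k = unset (tab s) k && (k != v).
    rewrite /s' /= /setA /= nat_eq.
    by case: (k == v); rewrite ?ltxx ?andbF ?andbT.
  have dku k : alive (tab s') k -> k != v -> ~~ dep k u.
    by move=> /as0/only_v e kv; move: e; rewrite (negbTE kv) => /norP[].
  apply: (round_inv_next inv au al') => //.
  - move=> k /as0 ak; rewrite only_v // /s' /setA /= nat_eq.
    by case: eqP => [->|_]; rewrite ?subr0.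
  - by move=> k ak; rewrite unE => /andP[-> kv]; rewrite dku.
  - apply: (@elim_parent _ _ (tab s) (tab s') u au su iu al' v) => //.
    + by rewrite al' av.
    + move=> l al; apply/negP => dul; have := only_v (as0 l al); rewrite dul /=.
      by move/esym/eqP => e; move: (dep_asym dul); rewrite e dvu.
    + move=> k b ak kv; rewrite /s' /= /rowF /setA /= !nat_eq (negbTE kv).
      by case: b.
    + split; first by rewrite /s' /= /rowF /setA /= !eqxx; apply/esym/surjective_pairing.
      by rewrite /s' /= /rowF /setA /= !eqxx; apply/esym/surjective_pairing.
have dvu : dep u v by move: duv; rewrite (negbTE ndvu) orbF.
rewrite (to_child_eq _ uv) /=; set s' := setA _ DEG _ _.
have al' := @alive_s1 s' (fun _ => erefl).
have as0 k : alive (tab s') k -> alive (tab s) k by rewrite al' => /andP[].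
have dku k : alive (tab s') k -> ~~ dep k u.
  move=> /as0/only_v e; apply/negP => dk; move: e; rewrite dk orbT => /esym/eqP e.
  by rewrite e (negbTE ndvu) in dk.
apply: (round_inv_next inv au al') => //.
- move=> k /as0 ak; rewrite only_v // /s' /setA /= nat_eq.
  by case: eqP => [->|_]; rewrite ?subr0.
- by move=> k ak uk; rewrite dku // andbT; exact: uk.
- apply: (@elim_child _ _ (tab s) (tab s') u au su iu al' v) => //.
  + by rewrite al' av.
  + by move=> l /as0/only_v e lv; move: e; rewrite (negbTE lv) => /norP[].
  + move=> k b ak kv; rewrite /s' /= /rowG /setA /= !nat_eq (negbTE kv).
    by case: b.
  + by case; rewrite /s' /= /setA /= !eqxx.
Qed.

End OneRound.

Lemma round_ok t s : (t < N)%N -> round_inv t s ->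
  round_inv t.+1 (eval round (bind r0 2 t) s).
Proof.
move=> tN inv; have [_ ct _ hG _] := inv.
have : (0 < #|[pred k | alive (tab s) k]|)%N by lia.
move=> /card_gt0P[k0 ak0].
have [u0 au0 d0] := dep_leaf lin cons simp acyc ak0.
pose p i := 0 < ((s DEAD i < 1)%R : nat)%:R * ((s DEG i < 2%:R)%R : nat)%:R :> rat.
have pE (k : 'I_N) : p k = alive (tab s) k && (#|neighbours s k| <= 1)%N.
  rewrite /p -natrM mulnb gt0_bool (_ : (s DEAD k < 1) = alive (tab s) k) //.
  by case: (boolP (alive (tab s) k)) => // ak; rewrite !andTb hG // ltr_nat.
have [|xN px] := @find_last_spec p N.
  by exists (nat_of_ord u0) => //; rewrite pE d0 andbT.
set x := find_last _ N in xN px *; pose u := Ordinal xN.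
have := pE u; rewrite px => /esym/andP[au d1].
pose r := bind (bind r0 2 t) 3 u; pose s1 := setA s DEAD u 1.
rewrite (_ : eval round (bind r0 2 t) s =
  if 0 < ((s DEG u < 1)%R : nat)%:R :> rat then eval finish r s1
  else loop (fun i => eval pass_on (bind r 4 i)) N s1) // gt0_bool (hG u au) ltrn1.
case: ifP => h; first by apply: finish_ok => //; lia.
have /card1P[v ev] : #|neighbours s u| == 1%N by lia.
by apply: (@pass_on_ok t s u inv au d1 v).
Qed.

End Rounds.

Section Assembly.
Variables (n : nat) (M : {set {set 'I_n}}) (C : {set {set {set 'I_n}}}).
Variable a : {set 'I_n} -> rat.
Hypothesis lin : is_linearization M C.
Hypothesis cons : consistent M C.
Hypothesis simp : simple_lin M C.
Hypothesis acyc : acyclic_G M C.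

Local Notation N := #|M|.
Local Notation r0 := (env0 n N).
Local Notation obj := (objective M a).

Lemma rounds_start :
  round_inv M C a 0 (eval degrees r0 (eval rows r0 (eval codes r0 (arrays0 (encode M C a))))).
Proof.
have [cs1 z1] := codes_ok M C a.
have [cs2 hU hD z2] := rows_ok lin cons simp acyc cs1 z1.
have [e3 h3] := degrees_ok cs2 hU hD z2.
move: e3 h3 cs2 hU hD z2; set s3 := eval degrees r0 _; move: s3 => s3.
move: (eval rows _ _) => s2 e3 h3 [_ cP _] hU hD z2.
have z3 h j : ~~ (h \in [:: X; POW; CODE; SJ; DEP; UNS] ++ [:: DEG; 'G1; 'G1c]) ->
    s3 h j = 0.
  by rewrite mem_cat negb_or => /andP[n2 n3]; rewrite e3 ?z2.
have al k : alive (tables_of N s3) k by rewrite /= z3 // ltr01.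
have un k : unset (tables_of N s3) k = nonsingle (mono M k).
  by rewrite /= e3 // hU ?ltn_ord // gt0_bool.
split.
- apply: (represents_init lin cons simp) => //.
  + by move=> k [] /=; rewrite !z3.
  + by move=> k /=; rewrite !z3.
  + move=> k /=; have [-> -> _] := h3 k (ltn_ord k); rewrite ltn_ord.
    by case: (nonsingle _).
  + by rewrite /= !z3.
- by rewrite addn0 -[RHS]card_ord; apply: eq_card => k; rewrite !inE al.
- by split=> [k l|i le]; rewrite e3 // ?hD ?cP ?ltn_ord.
- move=> k _; have [_ _ ->] := h3 k (ltn_ord k); rewrite ltn_ord.
  rewrite -(sum1_card (neighbours C s3 k)) natr_sum [RHS]big_mkcond; apply: eq_bigr => l _.
  rewrite !inE al -[arc M C _ _]/(dep C k l) -[arc M C (mono M l) _]/(dep C l k) /=.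
  case: (boolP (dep C k l)) => [/(dep_asym lin cons simp)/negbTE -> |_].
    by rewrite addr0.
  by case: (dep C l k); rewrite add0r.
- by move=> k _; rewrite un.
Qed.

Lemma rounds_ok s : round_inv M C a 0 s -> round_inv M C a N (eval (For 2 1 round) r0 s).
Proof.
by move=> inv; apply: loop_ind => // i s' iN; apply: round_ok.
Qed.

Lemma decode_ok s (x : {ffun 'I_n -> bool}) :
  (forall i, (i <= n)%N -> s POW i = weight i) ->
  s 'Kc 0%N = code [set i | x i] ->
  let s' := eval decode r0 s in
  s' OUT 0%N = s 'K 0%N /\ forall i : 'I_n, s' OUT i.+1 = (x i : nat)%:R.
Proof.
move=> hP hK; pose b := bit [set i | x i].
pose body i s := let s' := setA s OUT (i + 1) (1 - ((s 'Kc 0%N < s POW i)%R : nat)%:R) in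
  setA s' 'Kc 0 (s' 'Kc 0%N - s' OUT (i + 1)%N * s' POW i).
rewrite (_ : eval decode r0 s = loop body n (setA s OUT 0 (s 'K 0%N))) //=.
pose I i (s' : arrays) := [/\ s' 'Kc 0%N = tail n b i, s' OUT 0%N = s 'K 0%N,
  forall j, s' POW j = s POW j & forall j, (j < i)%N -> s' OUT j.+1 = (b j : nat)%:R].
have [|i s' iN [h1 h2 h3 h4]|_ h2 _ h4] :=
    @loop_ind I body n (setA s OUT 0 (s 'K 0%N)) _ _; first by split=> //; rewrite -codeE.
  have o : 1 - ((s' 'Kc 0%N < s' POW i)%R : nat)%:R = (b i : nat)%:R :> rat.
    rewrite h1 h3 hP ?tail_digit //; last exact: ltnW.
    by case: (b i); rewrite /= ?subr0 ?subrr.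
  rewrite /body o; split.
  - rewrite /setA /= eqxx h1 h3 hP; last exact: ltnW.
    by rewrite (tail_rec b iN) addrC addKr.
  - by rewrite /setA /= addn1.
  - exact: h3.
  - move=> j ji; rewrite /setA /= addn1 eqSS; case: eqP => [->//|ne].
    by apply: h4; lia.
by split=> // i; rewrite h4 // /b bitE inE.
Qed.

Lemma program_ok : exists x : {ffun 'I_n -> bool},
  let s := eval program r0 (arrays0 (encode M C a)) in
  [/\ forall i : 'I_n, s OUT i.+1 = (x i : nat)%:R, s OUT 0%N = obj x &
      forall y, obj x <= obj y].
Proof.
have := rounds_ok rounds_start.
rewrite -[eval program _ _]/(eval decode r0 (eval (For 2 1 round) r0 (eval degrees r0
  (eval rows r0 (eval codes r0 (arrays0 (encode M C a))))))).
move: (eval (For 2 1 round) _ _) => s [rp ct [_ hP] _ _].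
have [|x [[eK eKc] opt]] := represents_end rp.
  move=> k; apply/negP => ak.
  have : (0 < #|[pred k | alive (tables_of N s) k]|)%N by apply/card_gt0P; exists k.
  lia.
exists x; have [e1 e2] := decode_ok hP eKc.
by split; [exact: e2 | exact: etrans e1 eK | exact: opt].
Qed.

End Assembly.

Theorem theorem5p5 :
  exists (P : seq instr) (c N0 : nat),
    forall (n : nat) (M : {set {set 'I_n}}) (C : {set {set {set 'I_n}}})
           (a : {set 'I_n} -> rat),
      is_linearization M C -> consistent M C -> simple_lin M C ->
      acyclic_G M C ->
      exists (t : nat) (mf : memory),
        halts_in P (encode M C a) t mf /\
        correct_output M a mf /\
        ((N0 <= #|M|)%N -> (t <= c * #|M| ^ 2)%N).
Proof.
exists (compile program), (ccost 1 program + 110 * 100)%N, 1%N.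
move=> n M C a lin cons simp acyc.
have nN : (n <= #|M|)%N by rewrite -(card_MC lin simp) leq_addl.
have [t [mf [hh ho ht]]] := compile_correct program_wf program_depth nN
  (erefl : encode M C a 0 = n%:R) erefl (encode_end a lin simp).
have [x [ox o0 opt]] := program_ok a lin cons simp acyc.
exists t, mf; split; [exact: hh | split; [|exact: ht]].
exists x; split; first by move=> i; rewrite (ho _ (ltn_ord i)); apply: ox.
by split; [rewrite (ho _ (leq0n n)); apply: o0 | exact: opt].
Qed.
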